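(* Let $\aleph$ be an infinite cardinal, $\mathbb K$ a field, $I$ an $\aleph$-poset having a finite cofinal subset, and $J$ a subset of $I$. For every ordinal $\alpha$ we have $$\mathrm{Soc}_\alpha(H(I,J))=H(I,J_\alpha).$$ Consequently $H(I,J)$ is semiartinian if and only if $J$ is artinian, in which case the Loewy length of $H(I,J)$ equals the dual classical Krull dimension of $J$. In particular $\mathfrak B(I)$ is semiartinian if and only if $I$ is artinian.
   Context: The dual classical Krull filtration $(J_\alpha)_{\alpha\ge 0}$ of a poset $J$ is defined by $J_0=\emptyset$, $J_{\alpha+1}=J_\alpha\cup\{\text{minimal elements of }J\setminus J_\alpha\}$, and $J_\alpha=\bigcup_{\beta<\alpha}J_\beta$ for $\alpha$ a limit ordinal. A poset $J$ is artinian if it satisfies the descending chain condition; equivalently $J=J_\xi$ for some ordinal $\xi$, and the smallest such $\xi$ is the dual classical Krull dimension of $J$. For a (not necessarily unital) regular ring $R$ (the algebras $H(I,J)$ below are von Neumann regular), $\mathrm{Soc}(R)$ is the sum of all minimal right ideals (it coincides with the sum of all minimal left ideals), and the Loewy chain is $\mathrm{Soc}_0(R)=0$, $\mathrm{Soc}_{\alpha+1}(R)/\mathrm{Soc}_\alpha(R)=\mathrm{Soc}(R/\mathrm{Soc}_\alpha(R))$, and $\mathrm{Soc}_\alpha(R)=\bigcup_{\beta<\alpha}\mathrm{Soc}_\beta(R)$ for $\alpha$ limit. $R$ is semiartinian if $R=\mathrm{Soc}_\xi(R)$ for some ordinal $\xi$; the smallest such $\xi$ is its Loewy length. Conventions.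 $\aleph$ is an infinite cardinal, regarded as an initial ordinal, so that $\emptyset\in\aleph$; $\mathbb K$ is a field. For a poset $P$, $\mathcal M(P)$ is the set of all maximal chains of $P$ (maximal totally ordered subsets). An $\aleph$-poset is a partially ordered set $I$ with $|I|\le\aleph$ and $|\mathcal M(I)|\le\aleph$. For $i\in I$: $\{i\le\}=\{k\in I: i\le k\}$, $\{\le i\}=\{k\in I:k\le i\}$, $\{i\not\le\}=I\setminus\{i\le\}$, with the induced orders. For a set $A$, $\aleph^{(A)}$ is the set of maps $p:A\to\aleph$ with $p(a)=\emptyset$ for all but finitely many $a\in A$. For a set $X$, $\mathrm{CFM}_X(\mathbb K)$ is the $\mathbb K$-algebra of column-finite $X\times X$ matrices over $\mathbb K$, and $\mathrm{FR}_X(\mathbb K)$ is its ideal of matrices with only finitely many nonzero rows; $a(x,y)$ denotes the entry of $a$ in row $x$, column $y$. Construction. Let $X(I)=\aleph^{(I)}\times\mathcal M(I)$ and $Q(I)=\mathrm{CFM}_{X(I)}(\mathbb K)$. For $i\in I$ let $X(i\le)=\aleph^{(\{i\le\})}\times\mathcal M(\{i\le\})$ and let $\psi_{I,i}:\mathrm{CFM}_{X(i\le)}(\mathbb K)\to Q(I)$ be the injective (not necessarily unital) $\mathbb K$-algebra homomorphism given, for $p,q\in\aleph^{(I)}$ and $A,B\in\mathcal M(I)$, by $$\psi_{I,i}(a)((p,A),(q,B))=a\big((p|_{\{i\le\}},A\cap\{i\le\}),(q|_{\{i\le\}},B\cap\{i\le\})\big)$$ if $i\in A\cap B$, $A\cap\{\le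 i\}=B\cap\{\le i\}$ and $p|_{\{i\not\le\}}=q|_{\{i\not\le\}}$, and $\psi_{I,i}(a)((p,A),(q,B))=0$ otherwise. Put $H(I,i)=\psi_{I,i}(\mathrm{FR}_{X(i\le)}(\mathbb K))$ if $i$ is not a maximal element of $I$, and $H(I,i)=\mathbb K\,\psi_{I,i}(\mathbf 1)$ if $i$ is a maximal element of $I$. For $J\subseteq I$ put $H(I,J)=\sum_{j\in J}H(I,j)\subseteq Q(I)$; this sum is direct and $H(I,J)$ is a (not necessarily unital) $\mathbb K$-subalgebra of $Q(I)$. Finally $\mathfrak B(I)=H(I,I)$, which is a unital subalgebra of $Q(I)$ when $I$ has a finite cofinal subset. *)

(* Defs.v *)
From HB Require Import structures.
From mathcomp Require Import all_boot all_order all_algebra.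
From mathcomp Require Import boolp classical_sets functions cardinality fsbigop.

Set Implicit Arguments.
Unset Strict Implicit.
Unset Printing Implicit Defensive.

Import Order.TTheory GRing.Theory.

Local Open Scope classical_set_scope.
Local Open Scope card_scope.

(* An ordinal is given as an element w of a well-ordered set W and stands for
   the order type of {v : W | v < w}.  The order type of any well-ordered set
   is obtained in this way, by adjoining a top element, and the ordinals below
   w are exactly those given by the elements v < w of W. *)
Record woset := WOSet {
  wo_disp : Order.disp_t;
  wo_sort :> orderType wo_disp;
  wo_wf : well_founded (fun v w : wo_sort => (v < w)%O = true) }.

Section Transfinite.
Variable W : woset.
Implicit Types v w : W.

Definition ord_zero w := forall v, (w <= v)%O.
Definition ord_succ v w := (v < w)%O /\ forall u, (u < w)%O -> (u <= v)%O.
Definition ord_limit w := ~ ord_zero w /\ ~ exists v, ord_succ v w.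

Variables (T : Type) (base : set T) (next : set T -> set T).

(* The family with value base at 0, next (C v) at the successor of v, and the
   union of the previous values at limits; see the three lemmas below. *)
Definition transfinite : W -> set T :=
  Fix (@wo_wf W) (fun _ => set T) (fun w C =>
    [set x | [\/ ord_zero w /\ base x,
                 exists v (vw : (v < w)%O), ord_succ v w /\ next (C v vw) x
               | ord_limit w /\ exists v (vw : (v < w)%O), C v vw x]]).

Lemma transfiniteE w : transfinite w =
  [set x | [\/ ord_zero w /\ base x,
               exists v (_ : (v < w)%O), ord_succ v w /\ next (transfinite v) x
             | ord_limit w /\ exists v (_ : (v < w)%O), transfinite v x]].
Proof.
rewrite {1}/transfinite Fix_eq // => {}w f g fg.
suff -> : f = g by [].
by apply: functional_extensionality_dep => v;
  apply: functional_extensionality_dep => vw.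
Qed.

Lemma transfinite0 w : ord_zero w -> transfinite w = base.
Proof.
move=> w0; rewrite transfiniteE; apply/seteqP; split=> x /=; last by move=> ?; apply: Or31.
by case=> [[_ //]|[v [vw _]]|[[]] //]; have := w0 v; rewrite leNgt vw.
Qed.

Lemma transfinite_succ v w :
  ord_succ v w -> transfinite w = next (transfinite v).
Proof.
move=> vw; rewrite transfiniteE; apply/seteqP; split=> x /=.
  case=> [[w0 _]|[u [_ [uw]]]|[[_ []]]]; last by exists v.
    by have := w0 v; rewrite leNgt vw.1.
  suff -> : u = v by [].
  by apply: le_anti; rewrite vw.2 ?uw.1 //= uw.2 // vw.1.
by move=> ?; apply: Or32; exists v, vw.1.
Qed.

Lemma transfinite_limit w :
  ord_limit w -> transfinite w = \bigcup_(v in [set v | (v < w)%O]) transfinite v.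
Proof.
move=> lw; rewrite transfiniteE; apply/seteqP; split=> x /=.
  case=> [[w0 _]|[v [_ [vw _]]]|[_ [v [vw]]]]; last by exists v.
    by case: lw.1.
  by case: lw.2; exists v.
by case=> v /= vw ?; apply: Or33; split => //; exists v, vw.
Qed.

End Transfinite.

(* The subset J carries the order induced by I. *)
Section Krull.
Variables (d : Order.disp_t) (I : porderType d).
Implicit Types J : set I.

Definition minimal_elements J : set I :=
  [set x | J x /\ forall y, J y -> (y <= x)%O -> y = x].

Definition dual_krull J (W : woset) : W -> set I :=
  transfinite set0 (fun P => P `|` minimal_elements (J `\` P)).

Definition artinian_poset J :=
  ~ exists f : nat -> I, forall n, J (f n) /\ (f n.+1 < f n)%O.

Definition is_dual_krull_dim J (W : woset) (xi : W) :=
  dual_krull J xi = J /\ forall w : W, (w < xi)%O -> dual_krull J w <> J.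

End Krull.

(* A not necessarily unital ring is given by a carrier inside an ambient type
   with operations.  The ring laws, required on the carrier only, are not
   bundled, so that sub-objects and quotients can be formed before knowing
   that they are rings. *)
Record rng := Rng {
  rng_type : Type;
  rng_set : set rng_type;
  rng_zero : rng_type;
  rng_opp : rng_type -> rng_type;
  rng_add : rng_type -> rng_type -> rng_type;
  rng_mul : rng_type -> rng_type -> rng_type }.
Arguments rng_set : clear implicits.

Definition subrng (R : rng) (A : set (rng_type R)) : rng :=
  Rng A (rng_zero R) (@rng_opp R) (@rng_add R) (@rng_mul R).

Section Socle.
Variable R : rng.
Implicit Types M N S : set (rng_type R).

(* Sum of a family of additive subgroups: all finite sums of elements of
   members of the family. *)
Definition rng_sum (F : set (set (rng_type R))) : set (rng_type R) :=
  [set x | exists (n : nat) (f : 'I_n -> rng_type R),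
     (forall k, exists2 M, F M & M (f k)) /\
     x = \big[@rng_add R/rng_zero R]_(k < n) f k].

Definition right_ideal M :=
  [/\ M `<=` rng_set R, M (rng_zero R), forall x, M x -> M (rng_opp x),
      forall x y, M x -> M y -> M (rng_add x y)
    & forall x r, M x -> rng_set R r -> M (rng_mul x r)].

Definition minimal_right_ideal M :=
  [/\ right_ideal M, M <> [set rng_zero R]
    & forall N, right_ideal N -> N `<=` M -> N = [set rng_zero R] \/ N = M].

Definition Soc : set (rng_type R) := rng_sum minimal_right_ideal.

Definition coset S (x : rng_type R) : set (rng_type R) :=
  [set rng_add x s | s in S].

(* R/S, with cosets as elements.  In the product, S is added back since the
   set of products of two cosets can be a proper part of a coset. *)
Definition quotient_rng S : rng :=
  Rng [set coset S x | x in rng_set R] S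
    (fun C => [set rng_opp c | c in C])
    (fun C D => [set rng_add c d | c in C & d in D])
    (fun C D => [set rng_add (rng_mul cd.1 cd.2) s | cd in C `*` D & s in S]).

End Socle.
Arguments Soc : clear implicits.

Section Loewy.
Variable R : rng.

Definition Loewy (W : woset) : W -> set (rng_type R) :=
  transfinite [set rng_zero R]
    (fun S => [set x | rng_set R x /\ Soc (quotient_rng S) (coset S x)]).

Definition semiartinian := exists (W : woset) (xi : W), Loewy xi = rng_set R.

Definition is_Loewy_length (W : woset) (xi : W) :=
  Loewy xi = rng_set R /\ forall w : W, (w < xi)%O -> Loewy w <> rng_set R.

End Loewy.
Arguments Loewy R {W} _.
Arguments is_Loewy_length R {W} _.

Section Chains.
Variables (d : Order.disp_t) (I : porderType d).

Definition is_chain (A : set I) := total_on A (fun x y => (x <= y)%O).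

Definition maximal_chain : set (set I) :=
  [set A | is_chain A /\ forall B, is_chain B -> A `<=` B -> B = A].

Definition is_maximal (i : I) := forall k, (i <= k)%O -> k = i.

Definition has_finite_cofinal_subset :=
  exists2 F : set I, finite_set F & forall x, exists2 y, F y & (x <= y)%O.

Definition upset (i : I) := {k : I | (i <= k)%O}.

End Chains.

HB.instance Definition _ d (I : porderType d) (i : I) :=
  SubType.on (upset i).
HB.instance Definition _ d (I : porderType d) (i : I) :=
  Choice.on (upset i).
HB.instance Definition _ d (I : porderType d) (i : I) :=
  [SubChoice_isSubPOrder of upset i by <: with d].

(* A cardinal is represented by a type of that cardinality, whose point plays
   the role of the element 0 of the initial ordinal. *)
Definition aleph_poset (aleph : pointedType) d (I : porderType d) :=
  ([set: I] #<= [set: aleph]) /\ (@maximal_chain d I #<= [set: aleph]).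

Section Index.
Variable aleph : pointedType.

Record Xidx d (I : porderType d) := MkXidx {
  Xfun : I -> aleph;
  Xchain : set I;
  Xfun_fin : finite_set [set i | Xfun i != point];
  Xchain_max : maximal_chain Xchain }.

HB.instance Definition _ d (I : porderType d) := gen_eqMixin (Xidx I).
HB.instance Definition _ d (I : porderType d) := gen_choiceMixin (Xidx I).

Variables (d : Order.disp_t) (I : porderType d) (i : I).

Lemma fin_restrict (p : I -> aleph) : finite_set [set k | p k != point] ->
  finite_set [set k : upset i | p (val k) != point].
Proof.
move=> fp; apply: (@finite_preimage _ _ [set k | p k != point] val) => //.
by move=> x y _ _; apply: val_inj.
Qed.

Lemma maximal_chain_restrict (A : set I) : maximal_chain A -> A i ->
  maximal_chain [set k : upset i | A (val k)].
Proof.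
move=> [chA maxA] Ai; split=> [x y Ax Ay|B chB AB]; first exact: (chA _ _ Ax Ay).
have cmp x (z : upset i) : A x -> B z -> (x <= val z)%O \/ (val z <= x)%O.
  move=> Ax Bz; case: (chA _ _ Ai Ax) => [ix|xi].
    by apply: (chB (exist _ x ix) z) => //; apply: AB.
  by left; apply: le_trans xi (valP z).
have /maxA AE : is_chain (A `|` (val @` B)).
  move=> x y [Ax|[z Bz <-]] [Ay|[t Bt <-]].
  - exact: chA.
  - exact: cmp.
  - by case: (cmp _ _ Ay Bz); [right|left].
  - exact: (chB _ _ Bz Bt).
apply/seteqP; split=> // z Bz /=; rewrite -AE; last by move=> x; left.
by right; exists z.
Qed.

Definition Xrestrict (x : Xidx I) (xi : Xchain x i) : Xidx (upset i) :=
  MkXidx (fin_restrict (Xfun_fin x)) (maximal_chain_restrict (Xchain_max x) xi).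

End Index.

Section Matrices.
Variables (K : fieldType) (X : choiceType).
Implicit Types a b : X -> X -> K.
Local Open Scope ring_scope.

Definition CFM : set (X -> X -> K) :=
  [set a | forall y, finite_set [set x | a x y != 0]].

Definition FR : set (X -> X -> K) :=
  [set a | CFM a /\ finite_set [set x | exists y, a x y != 0]].

Definition mx_one : X -> X -> K := fun x y => (x == y)%:R.

(* The sum in the product is finite as soon as b is column-finite. *)
Definition CFM_rng : rng :=
  Rng CFM (fun _ _ => 0) (fun a x y => - a x y) (fun a b x y => a x y + b x y)
    (fun a b x y => \sum_(z \in [set: X]) a x z * b z y).

End Matrices.

Section Construction.
Variables (aleph : pointedType) (K : fieldType).
Variables (d : Order.disp_t) (I : porderType d).
Local Open Scope ring_scope.
Local Notation X := (@Xidx aleph d I).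
Local Notation Xup i := (@Xidx aleph d (upset i)).

Definition psi_cond (i : I) (x y : X) :=
  Xchain x `&` [set k | (k <= i)%O] = Xchain y `&` [set k | (k <= i)%O] /\
  forall k, ~~ (i <= k)%O -> Xfun x k = Xfun y k.

Definition psi (i : I) (a : Xup i -> Xup i -> K) : X -> X -> K :=
  fun x y => match pselect (Xchain x i), pselect (Xchain y i) with
  | left xi, left yi =>
      if `[< psi_cond i x y >] then a (Xrestrict xi) (Xrestrict yi) else 0
  | _, _ => 0
  end.

Arguments psi : clear implicits.

Definition H1 (i : I) : set (X -> X -> K) :=
  [set m | (~ is_maximal i /\ exists2 a, FR a & m = psi i a) \/
           (is_maximal i /\
            exists c : K, m = fun x y => c * psi i (@mx_one K (Xup i)) x y)].

Definition H (J : set I) : rng :=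
  subrng (rng_sum (R := CFM_rng K X) [set H1 j | j in J]).

Definition frakB : rng := H setT.

End Construction.

(* Main.v *)
(* Indices x, y of X(I) are compared by two equivalence relations for each
   i in I: agreement outside {i <=} (where psi_i may be nonzero) and equality of
   the restrictions to {i <=}.  In these terms H(I,i) consists of block-diagonal
   matrices repeating one block with finitely many nonzero rows, or of the
   scalar multiples of one idempotent if i is maximal; hence H(I,i)H(I,j) is
   contained in H(I,min(i,j)) if i and j are comparable, and vanishes otherwise.
   As aleph is infinite, a sum of elements of the H(I,i) has a nonzero entry
   coming from the component at any maximal element of its support alone, and
   this entry can be chosen in a column (q,B) such that B contains a prescribed
   k <= j.  This gives directness.

   Let L be a lower subset of J and S = H(I,L).  For j minimal in J \ L, each
   row of H(I,j) spans a minimal right ideal modulo S.  Conversely let M be a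
   right ideal minimal over S, x in M with support off L, j maximal in the
   support of x, and k < j in J \ L.  Multiplying x by a diagonal idempotent of
   H(I,k) which preserves a nonzero entry yields a nonzero element of M in
   H(I, {l in J \ L : l <= k}), so by minimality M lies in
   H(I, L u {l in J : l <= k}), which contradicts directness at j.  Hence the
   socle of H(I,J)/S is the image of H(I, L u min(J \ L)), and the theorem
   follows by transfinite induction. *)

Require Import Defs.
From HB Require Import structures.
From mathcomp Require Import all_boot all_order all_algebra.
From mathcomp Require Import boolp classical_sets functions cardinality fsbigop.
From mathcomp Require Import wochoice.

Set Implicit Arguments.
Unset Strict Implicit.
Unset Printing Implicit Defensive.
Import Order.TTheory GRing.Theory.
Local Open Scope classical_set_scope.

(** * Ordinals and the dual Krull filtration *)

Lemma wf_minimal (T : Type) (R : T -> T -> Prop) : well_founded R ->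
  forall P : T -> Prop, (exists x, P x) ->
  exists2 x, P x & forall y, R y x -> ~ P y.
Proof.
move=> wfR P [x Px]; apply: contrapT => nomin.
have : forall y, ~ P y; last by move/(_ x).
apply: (well_founded_ind wfR) => y IH Py.
by apply: nomin; exists y.
Qed.

Section Ordinals.
Variable W : woset.

Lemma ord_succ_above (v w : W) : (v < w)%O ->
  exists2 u, ord_succ v u & (u <= w)%O.
Proof.
move=> vw.
have [|u vu minu] := @wf_minimal _ _ (@wo_wf W) (fun u => (v < u)%O = true).
  by exists w.
exists u; last by rewrite leNgt; apply/negP => /minu.
split=> // t tu; rewrite leNgt; apply/negP => vt.
exact: (minu t tu).
Qed.

Lemma ord_cases (w : W) :
  [\/ ord_zero w, exists v, ord_succ v w | ord_limit w].
Proof.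
have [|w0] := pselect (ord_zero w); first by constructor 1.
have [|ws] := pselect (exists v, ord_succ v w); first by constructor 2.
by constructor 3.
Qed.

End Ordinals.

(** * Ordinals obtained from the well-ordering principle *)

Section WellOrder.
Variables (T : choiceType) (R : rel T) (woR : well_order R).

Lemma well_order_min (A : set T) : A !=set0 ->
  exists2 z, A z & forall y, A y -> R z y.
Proof.
move=> [x Ax]; have [|z [[zA zmin] _]] := woR (A := mem A).
  by exists x; rewrite inE.
by exists z => [|y Ay]; [rewrite inE in zA|apply: zmin; rewrite inE].
Qed.

Lemma well_order_total : total R.
Proof.
move=> x y; have [|z [->|->] zmin] := @well_order_min [set x; y].
- by exists x; left.
- by rewrite zmin //; right.
- by rewrite orbC zmin //; left.
Qed.

(** Both [x] and [y] would be minima of the pair {x, y}, and minima are unique. *)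
Lemma well_order_anti : antisymmetric R.
Proof.
move=> x y /andP[xy yx]; have Rxx z : R z z by have := well_order_total z z; rewrite orbb.
have [|z [_ zuniq]] := woR (A := mem [set x; y]); first by exists x; rewrite inE; left.
rewrite -(zuniq x) ?(zuniq y) //; split; rewrite ?inE; [by right| |by left|].
  by move=> t; rewrite inE => -[->|->].
by move=> t; rewrite inE => -[->|->].
Qed.

Lemma well_order_trans : transitive R.
Proof.
move=> y x z xy yz.
have Ranti := well_order_anti.
have [|t] := @well_order_min [set x; y; z]; first by exists x; left; left.
move=> [[->|->]|->] tmin.
- by apply: tmin; right.
- have yx : R y x by apply: tmin; left; left.
  by rewrite (Ranti x y) // xy yx.
- have zy : R z y by apply: tmin; left; right.
  by rewrite -(Ranti y z) // yz zy.
Qed.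

(** A copy of [T] tagged with the proof that [R] is a well-order, so that an order instance can be
    attached to it without touching [T] itself. *)
Definition wo_carrier of well_order R : Type := T.
Local Notation C := (wo_carrier woR).
HB.instance Definition _ := Choice.on C.
HB.instance Definition _ := @Order.isOrder.Build (Order.Disp tt tt) C
  R (fun x y => (y != x) && R x y) _ _ (fun _ _ => erefl) (fun _ _ => erefl)
  (fun _ _ => erefl) well_order_anti well_order_trans
  well_order_total.

Lemma wo_carrier_wf : well_founded (fun x y : C => (x < y)%O = true).
Proof.
move=> x; apply: contrapT => nx.
have [|z nz zmin] := @well_order_min [set z | ~ Acc (fun x y : C => (x < y)%O = true) z].
  by exists x.
apply: nz; constructor => y yz; apply: contrapT => /zmin zy.
by have : ((z : C) <= y)%O := zy; rewrite leNgt yz.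
Qed.

End WellOrder.

Lemma well_orderable (T : choiceType) :
  exists (W : woset) (f : T -> W), injective f.
Proof.
have [R woR] := well_ordering_principle T.
by exists (WOSet (@wo_carrier_wf _ _ woR)), id.
Qed.

(** * Stages of the dual Krull filtration and the descending chain condition *)

Section KrullTheory.
Variables (d : Order.disp_t) (I : porderType d).
Implicit Types J L : set I.

(** This is the condition that makes H(I,L) a two-sided ideal of H(I,J). *)
Definition lower_in J L := L `<=` J /\
  forall x y, L x -> J y -> (y <= x)%O -> L y.

Lemma dual_krull_sub_succ J (W : woset) (v w : W) : ord_succ v w ->
  dual_krull J w = dual_krull J v `|` minimal_elements (J `\` dual_krull J v).
Proof. by move=> vw; rewrite /dual_krull (transfinite_succ _ _ vw). Qed.

Lemma dual_krull_mono J (W : woset) (v w : W) : (v <= w)%O ->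
  dual_krull J v `<=` dual_krull J w.
Proof.
elim/(well_founded_ind (@wo_wf W)): w v => w IH v.
rewrite le_eqVlt => /orP[/eqP->//|vw].
have [w0|[u uw]|lw] := ord_cases w.
- by have := w0 v; rewrite leNgt vw.
- rewrite (dual_krull_sub_succ _ uw).
  apply: subset_trans (IH _ uw.1 _ (uw.2 _ vw)) _.
  by move=> x; left.
- by move=> x xv; rewrite /dual_krull transfinite_limit //; exists v.
Qed.

Lemma dual_krull_lower J (W : woset) (w : W) : lower_in J (dual_krull J w).
Proof.
elim/(well_founded_ind (@wo_wf W)): w => w IH.
have [w0|[u uw]|lw] := ord_cases w.
- by rewrite /dual_krull transfinite0 //; split=> [x []|x y []].
- have [uJ lowu] := IH _ uw.1.
  rewrite (dual_krull_sub_succ _ uw); split=> [x [/uJ//|[[]//]]|x y].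
  case=> [ux|[_ minx]] Jy yx; first by left; apply: lowu yx.
  have [uy|nuy] := pselect (dual_krull J u y); first by left.
  right; have -> : y = x by apply: minx.
  split=> //; split; first by rewrite -(minx y).
  by rewrite -(minx y).
- rewrite /dual_krull transfinite_limit //; split.
    by move=> x [v vw]; apply: (IH v vw).1.
  by move=> x y [v vw vx] Jy yx; exists v => //; apply: (IH v vw).2 yx.
Qed.

Lemma artinian_minimal J L : artinian_poset J -> L `<=` J -> (exists x, L x) ->
  exists x, minimal_elements L x.
Proof.
move=> artJ LJ [x0 Lx0]; apply: contrapT => nomin.
have step (x : {x : I | L x}) : exists y : {x : I | L x}, (sval y < sval x)%O.
  apply: contrapT => nox; apply: nomin; exists (sval x).
  split; first exact: (svalP x).
  move=> y Ly yx; apply: contrapT => /eqP ynx; apply: nox.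
  by exists (exist _ y Ly); rewrite lt_neqAle ynx.
have [g gP] := choice step.
apply: artJ; exists (fun n => sval (iter n g (exist _ x0 Lx0))) => n.
by split; [apply: LJ; apply: svalP|apply: gP].
Qed.

(* Hartogs' argument: if the filtration never reached J along a well-order of
   the power set of I, picking a new element at each step would inject that
   power set into I. *)
Lemma artinian_dual_krull J : artinian_poset J ->
  exists (W : woset) (xi : W), dual_krull J xi = J.
Proof.
move=> artJ; have [W [f injf]] := well_orderable (set I).
exists W; apply: contrapT => /forallNP notJ.
have new (w : W) : exists x, minimal_elements (J `\` dual_krull J w) x.
  apply: (artinian_minimal artJ) => [x []//|].
  apply: contrapT => none; apply: (notJ w); apply/seteqP; split.
    exact: (dual_krull_lower _ _).1.
  by move=> x Jx; apply: contrapT => nx; apply: none; exists x.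
have [g gP] := choice new.
(* [g v] is adjoined at the successor of [v], hence belongs to stage [w], whereas [g w] lies outside
   that stage. *)
have g_lt (v w : W) : (v < w)%O -> g v <> g w.
  move=> vw eg; have [u vu uw] := ord_succ_above vw.
  have [[_ nw] _] := gP w; apply: nw; rewrite -eg.
  apply: dual_krull_mono uw _ _.
  by rewrite (dual_krull_sub_succ _ vu); right; apply: gP.
have injg : injective (g \o f).
  move=> A B /= eg; apply: injf; apply: contrapT => /eqP.
  by rewrite neq_lt => /orP[/g_lt|/g_lt ne]; [apply|apply: ne; apply: esym].
(* Cantor's diagonal set: by injectivity, [g (f D)] can neither belong to [D] nor be missing from
   it. *)
pose D := [set x | exists2 A, x = g (f A) & ~ A x].
have [Dx|nDx] := pselect (D (g (f D))).
  by have [A /injg <-] := Dx.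
by apply: (nDx); exists D.
Qed.

(** The first stage containing some term [f n] of a descending sequence is a successor stage, at
    which [f n] is minimal among the elements not yet reached; but then the smaller [f n.+1] would
    have been reached earlier. *)
Lemma dual_krull_artinian J (W : woset) (xi : W) :
  dual_krull J xi = J -> artinian_poset J.
Proof.
move=> JE [f fP].
have [|w [n fnw] minw] := @wf_minimal _ _ (@wo_wf W)
    (fun w => exists n, dual_krull J w (f n)).
  by exists xi, 0; rewrite JE; case: (fP 0).
have [w0|[u uw]|lw] := ord_cases w.
- by move: fnw; rewrite /dual_krull transfinite0.
- move: fnw; rewrite (dual_krull_sub_succ _ uw) => -[fnu|[_ minfn]].
    by apply: (minw u uw.1); exists n.
  have : f n.+1 = f n.
    apply: minfn; last by rewrite ltW //; case: (fP n).
    split; first by case: (fP n.+1).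
    by move=> fu; apply: (minw u uw.1); exists n.+1.
  by have [_] := fP n; rewrite lt_neqAle => /andP[/eqP].
- move: fnw; rewrite /dual_krull transfinite_limit // => -[v vw fnv].
  by apply: (minw v vw); exists n.
Qed.

End KrullTheory.

(** * The socle of a quotient ring *)

Section QuotientSocle.
Local Open Scope ring_scope.
Variables (V : zmodType) (A : set V) (mul : V -> V -> V).
Local Notation R := (Rng A 0 -%R +%R mul).
Hypothesis A_opp : forall x, A x -> A (- x).
Hypothesis A_add : forall x y, A x -> A y -> A (x + y).
Hypothesis A_mul : forall x y, A x -> A y -> A (mul x y).
Hypothesis mulDl : forall x y z, A x -> A y -> A z ->
  mul (x + y) z = mul x z + mul y z.
Hypothesis mulDr : forall x y z, A x -> A y -> A z ->
  mul x (y + z) = mul x y + mul x z.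

Variable S : set V.
Hypothesis SA : S `<=` A.
Hypothesis S0 : S 0.
Hypothesis S_opp : forall x, S x -> S (- x).
Hypothesis S_add : forall x y, S x -> S y -> S (x + y).
Hypothesis S_mull : forall x y, A x -> S y -> S (mul x y).
Hypothesis S_mulr : forall x y, S x -> A y -> S (mul x y).

Local Notation Q := (@quotient_rng R S).
Local Notation cos := (@coset R S).

Lemma cosetP x y : cos x y <-> S (y - x).
Proof.
split=> [[s Ss <-]|Sxy]; first by rewrite /= addrC addKr.
by exists (y - x) => //=; rewrite addrC subrK.
Qed.

Lemma coset_eqP x y : cos x = cos y <-> S (x - y).
Proof.
split=> [xy|Sxy]; first by apply/cosetP; rewrite -xy; apply/cosetP; rewrite subrr.
apply/seteqP; split=> z /cosetP Sz; apply/cosetP.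
  by rewrite -(subrK x z) -addrA; apply: S_add.
by rewrite -(subrK y z) -addrA; apply: S_add => //; rewrite -opprB; apply: S_opp.
Qed.

Lemma coset0 : cos 0 = S.
Proof.
by apply/seteqP; split=> x; [move/cosetP|move=> Sx; apply/cosetP]; rewrite subr0.
Qed.

Lemma coset_eqS x : cos x = S <-> S x.
Proof.
have := coset_eqP x 0; rewrite coset0 subr0; exact.
Qed.

Lemma coset_opp x : rng_opp (r := Q) (cos x) = cos (- x).
Proof.
apply/seteqP; split=> z.
  move=> [y /cosetP Sy <-]; apply/cosetP; rewrite /= -opprD; exact: S_opp.
move=> /cosetP Sz; exists (- z); last by rewrite /= opprK.
by apply/cosetP; rewrite -opprD; apply: S_opp; rewrite opprK in Sz.
Qed.

Lemma coset_add x y : rng_add (r := Q) (cos x) (cos y) = cos (x + y).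
Proof.
apply/seteqP; split=> z.
  move=> [a /cosetP Sa [b /cosetP Sb <-]]; apply/cosetP => /=.
  by rewrite opprD addrACA; apply: S_add.
move=> /cosetP Sz; exists x; first by apply/cosetP; rewrite subrr.
exists (z - x) => /=; last by rewrite addrC subrK.
by apply/cosetP; rewrite -addrA -opprD.
Qed.

Lemma coset_mul x y : A x -> A y ->
  rng_mul (r := Q) (cos x) (cos y) = cos (mul x y).
Proof.
move=> Ax Ay; apply/seteqP; split=> z.
  move=> [[a b] [/= [s Ss <-] [t St <-]] [u Su <-]]; apply/cosetP => /=.
  have As := SA Ss; have At := SA St.
  rewrite mulDl // ?mulDr //; last exact: A_add.
  rewrite -!addrA addrC -!addrA addNr addr0.
  by do !apply: S_add => //; [apply: S_mull|apply: S_mulr|apply: S_mulr].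
move=> /cosetP Sz; exists (x, y).
  by split=> /=; apply/cosetP; rewrite subrr.
by exists (z - mul x y) => //=; rewrite addrC subrK.
Qed.

(** By the correspondence between right ideals of R/S and right ideals of R containing S, these are
    the preimages of the minimal right ideals of R/S. They allow the later arguments to work with
    elements instead of cosets. *)
Definition minimal_over (M : set V) :=
  [/\ right_ideal (R := R) M, S `<=` M, M <> S
    & forall N, right_ideal (R := R) N -> S `<=` N -> N `<=` M -> N = S \/ N = M].

Lemma image_right_ideal M : right_ideal (R := R) M -> S `<=` M ->
  right_ideal (R := Q) [set cos x | x in M].
Proof.
move=> [MA M0 MN MD MM] SM; split.
- by move=> _ [x Mx <-]; exists x => //; apply: MA.
- by exists 0 => //; rewrite coset0.
- by move=> _ [x Mx <-]; rewrite coset_opp; exists (- x) => //; apply: MN.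
- by move=> _ _ [x Mx <-] [y My <-]; rewrite coset_add; exists (x + y) => //; apply: MD.
- move=> _ _ [x Mx <-] [r Ar <-]; rewrite coset_mul //; last exact: MA.
  by exists (mul x r) => //; apply: MM.
Qed.

Lemma preimage_right_ideal N : right_ideal (R := Q) N ->
  right_ideal (R := R) [set x | A x /\ N (cos x)] /\
  S `<=` [set x | A x /\ N (cos x)].
Proof.
move=> [NA N0 NN ND NM]; split; first split.
- by move=> x [].
- by split; [apply: SA|rewrite coset0].
- by move=> x [Ax Nx]; split; [apply: A_opp|rewrite -coset_opp; apply: NN].
- by move=> x y [Ax Nx] [Ay Ny]; split; [apply: A_add|rewrite -coset_add; apply: ND].
- move=> x r [Ax Nx] Ar; split; first exact: A_mul.
  by rewrite -coset_mul //; apply: NM => //; exists r.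
- move=> x Sx; split; first exact: SA.
  by have -> : cos x = S by apply/coset_eqS.
Qed.

Lemma image_preimage N : right_ideal (R := Q) N ->
  [set cos x | x in [set x | A x /\ N (cos x)]] = N.
Proof.
move=> [NA _ _ _ _]; apply/seteqP; split=> [_ [x [_ Nx] <-]//|C NC].
by have [x Ax xC] := NA _ NC; exists x => //; split; rewrite ?xC.
Qed.

Lemma preimage_image M : right_ideal (R := R) M -> S `<=` M ->
  [set x | A x /\ [set cos x | x in M] (cos x)] = M.
Proof.
move=> [MA _ _ MD _] SM; apply/seteqP; split=> x.
  move=> [Ax [y My /coset_eqP Syx]].
  rewrite -[x](addrNK y) addrC; apply: MD => //; apply: SM.
  by rewrite -opprB; apply: S_opp.
by move=> Mx; split; [apply: MA|exists x].
Qed.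

Lemma minimal_over_image M : minimal_over M ->
  minimal_right_ideal (R := Q) [set cos x | x in M].
Proof.
move=> [riM SM MS minM]; split; first exact: image_right_ideal.
  move=> M0; apply: MS; apply/seteqP; split=> // x Mx.
  have : [set cos x | x in M] (cos x) by exists x.
  by rewrite M0 => /coset_eqS.
move=> N riN NM; have [riN' SN'] := preimage_right_ideal riN.
case: (minM _ riN' SN').
- by rewrite -(preimage_image riM SM) => x [Ax Nx]; split=> //; apply: NM.
- move=> NS; left; rewrite -(image_preimage riN) NS.
  apply/seteqP; split=> [_ [x Sx <-]|_ ->].
    exact/coset_eqS.
  by exists 0 => //; rewrite coset0.
- by move=> NM'; right; rewrite -(image_preimage riN) NM'.
Qed.

Lemma minimal_over_preimage N : minimal_right_ideal (R := Q) N ->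
  minimal_over [set x | A x /\ N (cos x)].
Proof.
move=> [riN N0 minN]; have [riN' SN'] := preimage_right_ideal riN.
split=> //.
  move=> NS; apply: N0; rewrite -(image_preimage riN) NS.
  apply/seteqP; split=> [_ [x Sx <-]|_ ->].
    exact/coset_eqS.
  by exists 0 => //; rewrite coset0.
move=> M riM SM MN; case: (minN _ (image_right_ideal riM SM)).
- by rewrite -(image_preimage riN) => _ [x /MN Mx <-]; exists x.
- move=> M0; left; apply/seteqP; split=> // x Mx.
  have : [set cos x | x in M] (cos x) by exists x.
  by rewrite M0 => /coset_eqS.
- by move=> MN'; right; rewrite -(preimage_image riM SM) MN'.
Qed.

Lemma coset_sum n (g : 'I_n -> V) :
  \big[@rng_add Q/rng_zero Q]_(k < n) cos (g k) = cos (\sum_(k < n) g k).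
Proof.
elim: n g => [|n IH] g; first by rewrite !big_ord0 coset0.
by rewrite !big_ord_recl IH -coset_add.
Qed.

(** Each coset in a finite sum of members of minimal right ideals lifts to an element of a right
    ideal minimal over [S], and the error made by lifting stays in [S]. *)
Lemma Soc_quotientP x : A x -> Soc Q (cos x) <->
  exists2 r : seq V, (forall y, y \in r -> exists2 M, minimal_over M & M y) &
    S (x - \sum_(y <- r) y).
Proof.
move=> Ax; split=> [[n [f [fP xE]]]|[r rP Sx]].
  have fx k : exists y, f k = cos y /\ exists2 M, minimal_over M & M y.
    have [N minN Nf] := fP k.
    have [y Ay yE] : rng_set Q (f k) by case: minN => -[NA _ _ _ _] _ _; apply: NA.
    exists y; split=> //; exists [set x | A x /\ N (cos x)].
      exact: minimal_over_preimage.
    by split=> //; rewrite yE.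
  have [g gP] := choice fx.
  exists (map g (enum 'I_n)) => [y /mapP[k _ ->]|]; first by have [] := gP k.
  rewrite big_map big_enum /=; apply/coset_eqP; rewrite -coset_sum xE.
  by apply: eq_bigr => k _; have [] := gP k.
exists (size r), (fun k => cos (tnth (in_tuple r) k)); split.
  move=> k; have [|M minM Mg] := rP (tnth (in_tuple r) k); first exact: mem_tnth.
  exists [set cos x | x in M]; first exact: minimal_over_image.
  by exists (tnth (in_tuple r) k).
by rewrite coset_sum; apply/coset_eqP; rewrite big_tnth in Sx.
Qed.

End QuotientSocle.

(** * The index set *)

Lemma maximal_chainT d (I : porderType d) (C B : set I) : maximal_chain C -> is_chain B ->
  C `<=` B -> forall x, B x -> C x.
Proof. by move=> [_ maxC] chB CB x; rewrite (maxC _ chB CB). Qed.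

(** * Extending and gluing maximal chains *)

Section MaximalChains.
Variables (d : Order.disp_t) (I : porderType d).

Lemma maximal_chain_extend (C : set I) : is_chain C ->
  exists2 B, maximal_chain B & C `<=` B.
Proof.
move=> chC.
(* The Zorn hypothesis includes the empty family, so the sets [D] are not asked to contain [C]; only
   the union of [C] and [D] has to be a chain. *)
have [F Fch Ftot|B [BP Bmax]] :=
  @Zorn_bigcup I [set D | is_chain (C `|` D)].
  move=> x y xF yF.
  have pick z : (C `|` \bigcup_(X in F) X) z -> C z \/ exists2 X, F X & X z.
    by case; [left|right].
  case: (pick _ xF) => [Cx|[X FX Xx]]; case: (pick _ yF) => [Cy|[Y FY Yy]].
  - exact: chC.
  - by apply: (Fch _ FY); [left|right].
  - by apply: (Fch _ FX); [right|left].
  - have [XY|YX] := Ftot _ _ FX FY.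
      by apply: (Fch _ FY); right => //; apply: XY.
    by apply: (Fch _ FX); right => //; apply: YX.
exists (C `|` B); last by move=> x; left.
split=> // D chD BD; apply/seteqP; split=> // x Dx; apply: contrapT => nx.
apply: (Bmax D); last first.
  rewrite /= (_ : C `|` D = D) //; apply/seteqP; split=> y; last by right.
  by case=> // Cy; apply: BD; left.
split=> [y By|DB]; first by apply: BD; right.
by apply: nx; right; apply: DB.
Qed.

Lemma maximal_chain_mem (i : I) : exists2 B, maximal_chain B & B i.
Proof.
have [|B mB iB] := @maximal_chain_extend [set i].
  by move=> x y /= -> ->; left.
by exists B => //; apply: iB.
Qed.

(** An element comparable with the whole glued chain is comparable with [i]; if it lies above [i],
    maximality of [A] applies, and if below, maximality of [B]. *)
Lemma maximal_chain_glue (i : I) (A : set (upset i)) (B : set I) :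
  maximal_chain A -> maximal_chain B -> B i ->
  maximal_chain (val @` A `|` (B `&` [set k | (k <= i)%O])).
Proof.
move=> mA mB Bi.
have cA : is_chain A by case: mA.
have cB : is_chain B by case: mB.
(* As least element of {i <=}, [i] lies in every maximal chain there. *)
have Ai : A (exist _ i (lexx i)).
  apply: (maximal_chainT mA (B := A `|` [set exist _ i (lexx i)])).
  - move=> x y [Ax|->] [Ay|->]; [exact: cA| | |by left].
      by right; apply: (valP x).
    by left; apply: (valP y).
  - by move=> x; left.
  - by right.
have chG : is_chain (val @` A `|` (B `&` [set k | (k <= i)%O])).
  move=> x y [[u Au <-]|[Bx xi]] [[v Av <-]|[By yi]].
  - exact: cA.
  - by right; apply: le_trans yi (valP u).
  - by left; apply: le_trans xi (valP v).
  - exact: cB.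
split=> // D chD GD; apply/seteqP; split=> // x Dx.
have Di : D i by apply: GD; left; exists (exist _ i (lexx i)).
have [ix|xi] := chD _ _ Di Dx.
  left; exists (exist _ x ix) => //.
  apply: (maximal_chainT mA (B := [set k : upset i | D (val k)])) => //.
    by move=> u v Du Dv; apply: (chD _ _ Du Dv).
  by move=> u Au; apply: GD; left; exists u.
right; split=> //.
apply: (maximal_chainT mB (B := B `|` (D `&` [set k | (k <= i)%O]))).
- have cmp y z : B y -> D z -> (z <= i)%O -> (y <= z)%O \/ (z <= y)%O.
    move=> By Dz zi; have [iy|yi] := cB _ _ Bi By.
      by right; apply: le_trans zi iy.
    by apply: chD => //; apply: GD; right.
  move=> y z [By|[Dy yi]] [Bz|[Dz zi]]; [exact: cB|exact: cmp| |exact: chD].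
  by have [|] := cmp z y Bz Dy yi; [right|left].
- by move=> y; left.
- by right.
Qed.

End MaximalChains.

(** * The two equivalence relations on indices *)

Section IndexRelations.
Variables (aleph : pointedType) (d : Order.disp_t) (I : porderType d).
Local Notation X := (@Xidx aleph d I).
Implicit Types (x y z w : X) (i j k : I).

Lemma Xidx_ext d' (P : porderType d') (x y : @Xidx aleph d' P) :
  Xfun x = Xfun y -> Xchain x = Xchain y -> x = y.
Proof.
case: x y => [p A fp mA] [q B fq mB] /= pq AB; rewrite {}pq {}AB in fp mA *.
by congr MkXidx; apply: Prop_irrelevance.
Qed.

Lemma Xchain_total x i j : Xchain x i -> Xchain x j -> (i <= j)%O \/ (j <= i)%O.
Proof. by case: (Xchain_max x) => cx _; apply: cx. Qed.

(* [sim i] is the relation on indices outside of which psi i vanishes, and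
   [same i x y] means that x and y have the same restriction to {i <=}.  An
   index is determined by its sim i class and its same i class. *)
Definition sim i x y := [/\ Xchain x i, Xchain y i & psi_cond i x y].

Definition same i x y := [/\ Xchain x i, Xchain y i,
  forall k, (i <= k)%O -> Xchain x k <-> Xchain y k &
  forall k, (i <= k)%O -> Xfun x k = Xfun y k].

Lemma simP i x y : sim i x y <-> [/\ Xchain x i, Xchain y i,
  forall k, (k <= i)%O -> Xchain x k <-> Xchain y k &
  forall k, ~~ (i <= k)%O -> Xfun x k = Xfun y k].
Proof.
split=> -[xi yi].
  move=> [c f]; split=> // k ki; move/seteqP: c => [cl cr].
  by split=> h; [case: (cl k)|case: (cr k)].
move=> c f; split=> //; split=> //; apply/seteqP.
by split=> k [] h ki; split=> //; apply/c.
Qed.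

Lemma sim_refl i x : Xchain x i -> sim i x x.
Proof. by move=> xi; apply/simP; split. Qed.

Lemma sim_sym i x y : sim i x y -> sim i y x.
Proof.
move=> /simP[xi yi c f]; apply/simP; split=> // k ki.
  by split=> ?; apply/c.
by rewrite f.
Qed.

Lemma sim_trans i x y z : sim i x y -> sim i y z -> sim i x z.
Proof.
move=> /simP[xi yi c f] /simP[_ zi c' f']; apply/simP; split=> // k ki.
  by split=> [/(c _ ki)/(c' _ ki)|/(c' _ ki)/(c _ ki)].
by rewrite f // f'.
Qed.

Lemma same_refl i x : Xchain x i -> same i x x.
Proof. by move=> xi; split. Qed.

Lemma same_sym i x y : same i x y -> same i y x.
Proof.
move=> [xi yi c f]; split=> // k ki; last by rewrite f.
by split=> ?; apply/c.
Qed.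

Lemma same_trans i x y z : same i x y -> same i y z -> same i x z.
Proof.
move=> [xi yi c f] [_ zi c' f']; split=> // k ki; last by rewrite f // f'.
by split=> [/(c _ ki)/(c' _ ki)|/(c' _ ki)/(c _ ki)].
Qed.

Lemma sim_same_eq i x y : sim i x y -> same i x y -> x = y.
Proof.
move=> /simP[xi yi c f] [_ _ c' f']; apply: Xidx_ext.
  apply/funext => k; have [ik|] := boolP (i <= k)%O; first exact: f'.
  exact: f.
apply/seteqP; split=> k h.
  by have [ik|ki] := Xchain_total xi h; [apply/c'|apply/c].
by have [ik|ki] := Xchain_total yi h; [apply/c'|apply/c].
Qed.

(** As [i] grows, the part of an index fixed by [sim i] grows and the part fixed by [same i]
    shrinks, so the two relations vary in opposite directions. *)
Lemma sim_le i j x y : (i <= j)%O -> Xchain x i -> sim j x y -> sim i x y.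
Proof.
move=> ij xi /simP[xj yj c f]; apply/simP; split=> //.
- by apply/(c _ ij).
- by move=> k ki; apply: c; apply: le_trans ki ij.
- move=> k ik; apply: f; apply: contra ik; exact: le_trans.
Qed.

Lemma same_le i j x y : (i <= j)%O -> Xchain x j -> same i x y -> same j x y.
Proof.
move=> ij xj [xi yi c f]; split=> //.
- by apply/(c _ ij).
- by move=> k jk; apply: c; apply: le_trans jk.
- by move=> k jk; apply: f; apply: le_trans jk.
Qed.

(* The part of sim j above i <= j only depends on the restrictions to {i <=}. *)
Lemma sim_transfer i j x y x' y' : (i <= j)%O -> sim i x y -> sim i x' y' ->
  same i x x' -> same i y y' -> sim j x y -> sim j x' y'.
Proof.
move=> ij /simP[xi yi c f] /simP[xi' yi' c' f'] [_ _ cx fx] [_ _ cy fy].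
move=> /simP[xj yj cj fj]; apply/simP; split.
- by apply/cx.
- by apply/cy.
- move=> k kj; split=> h.
    have [ik|ki] := Xchain_total xi' h; last exact/c'.
    by apply/cy/cj/cx.
  have [ik|ki] := Xchain_total yi' h; last exact/c'.
  by apply/cx/cj/cy.
- move=> k jk; have [ik|] := boolP (i <= k)%O; last exact: f'.
  by rewrite -fx // -fy // fj.
Qed.

Lemma XrestrictP i x y (xi : Xchain x i) (yi : Xchain y i) :
  Xrestrict xi = Xrestrict yi <-> same i x y.
Proof.
split=> [xy|[_ _ c f]].
  split=> // k ik.
    have /= := congr1 (fun u => Xchain u (exist _ k ik : upset i)) xy.
    by rewrite propeqE.
  exact: (congr1 (fun u => Xfun u (exist _ k ik : upset i)) xy).
apply: Xidx_ext; first by apply/funext => -[k ik] /=; apply: f.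
by apply/seteqP; split=> -[k ik] /=; apply c.
Qed.

Lemma glue_up i z (u : @Xidx aleph d (upset i)) : Xchain z i ->
  exists w (wi : Xchain w i), Xrestrict wi = u /\ sim i w z.
Proof.
move=> zi.
pose p k := match boolP (i <= k)%O with
  AltTrue h => Xfun u (exist _ k h) | AltFalse _ => Xfun z k end.
have fp : finite_set [set k | p k != point].
  apply: (@sub_finite_set _ _ ((val @` [set k | Xfun u k != point]) `|`
      [set k | Xfun z k != point])).
    move=> k /=; rewrite /p; case: {-}_ / boolP => h pk; last by right.
    by left; exists (exist _ k h).
  rewrite finite_setU; split; last exact: Xfun_fin.
  by apply: finite_image; exact: Xfun_fin.
have mc := maximal_chain_glue (Xchain_max u) (Xchain_max z) zi.
pose w := MkXidx fp mc.
have wi : Xchain w i by right; split=> //=.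
(* Above [i] the glued chain is no larger than that of [u]: the lower part contributes at most [i],
   which is already in the maximal chain of [u]. *)
have wu (k : upset i) : Xchain w (val k) -> Xchain u k.
  move=> [[v uv /val_inj <-]//|[_ /= ki]].
  apply: (maximal_chainT (Xchain_max u) (B := Xchain u `|` [set k])).
  - have kmin (v : upset i) : (k <= v)%O by apply: le_trans ki (valP v).
    have [cu _] := Xchain_max u.
    by move=> a b [ua|->] [ub|->]; [apply: cu|right|left|left].
  - by move=> a; left.
  - by right.
exists w, wi; split.
  apply: Xidx_ext.
    apply/funext => k /=; rewrite /p; case: {-}_ / boolP => h.
      by congr Xfun; apply: val_inj.
    by have := valP k; rewrite (negbTE h).
  apply/seteqP; split=> k; first exact: wu.
  by move=> uk; left; exists k.
apply/simP; split=> //.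
  move=> k ki; split; last by right.
  move=> [[v uv vk]|[]//].
  have -> : k = i by apply/le_anti; rewrite ki -vk (valP v).
  exact: zi.
by move=> k ik /=; rewrite /p; case: {-}_ / boolP => h //; rewrite h in ik.
Qed.

(** With [sim_same_eq] this makes the indices through [i] a product: each [sim i] class meets each
    [same i] class in exactly one index. *)
Lemma Xglue i x y : Xchain x i -> Xchain y i ->
  exists2 w, sim i w x & same i w y.
Proof.
move=> xi yi; have [w [wi [wy wx]]] := glue_up (Xrestrict yi) xi.
by exists w => //; apply/XrestrictP.
Qed.

Lemma Xidx_mem i : exists x, Xchain x i.
Proof.
have [B mB Bi] := maximal_chain_mem i.
have f0 : finite_set [set k : I | (point : aleph) != point].
  apply: sub_finite_set (finite_set0 I) => k; by rewrite /= eqxx.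
by exists (MkXidx f0 mB).
Qed.

End IndexRelations.

(** * Finitely supported sums and products of column-finite matrices *)

Section FiniteSupportSums.
Local Open Scope ring_scope.
Variables (K : fieldType) (T : choiceType).

Lemma fsum_single (F : T -> K) z : (forall t, t <> z -> F t = 0) ->
  \sum_(t \in [set: T]) F t = F z.
Proof.
move=> F0; rewrite -(fsbig_widen [set z]) ?fsbig_set1 //.
by move=> t [_ tz]; apply: F0.
Qed.

(** A sum of infinite support takes the default value 0, so additivity is stated with a finite set
    carrying both supports. *)
Lemma fsum_add (F G : T -> K) (D : set T) : finite_set D ->
  (forall t, ~ D t -> F t = 0) -> (forall t, ~ D t -> G t = 0) ->
  \sum_(t \in [set: T]) (F t + G t) =
  \sum_(t \in [set: T]) F t + \sum_(t \in [set: T]) G t.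
Proof.
move=> fD F0 G0.
rewrite -[LHS](fsbig_widen D) // => [|t [_ Dt]]; last by rewrite /= F0 // G0 // addr0.
rewrite -[X in _ = X + _](fsbig_widen D) // => [|t [_ Dt]]; last exact: F0.
rewrite -[X in _ = _ + X](fsbig_widen D) // => [|t [_ Dt]]; last exact: G0.
exact: fsbig_split.
Qed.

Lemma fsum_bij (F G : T -> K) (P Q : set T) (h : T -> T) : set_bij P Q h ->
  (forall t, ~ Q t -> F t = 0) -> (forall t, ~ P t -> G t = 0) ->
  (forall t, P t -> F (h t) = G t) ->
  \sum_(t \in [set: T]) F t = \sum_(t \in [set: T]) G t.
Proof.
move=> bh F0 G0 FG.
rewrite -[LHS](fsbig_widen Q) // => [|t [_ Qt]]; last exact: F0.
rewrite -[RHS](fsbig_widen P) // => [|t [_ Pt]]; last exact: G0.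
rewrite (reindex_fsbig _ _ _ _ bh); apply: eq_fsbigr => t /set_mem; exact: FG.
Qed.

Lemma fsum_neq0 (F : T -> K) : \sum_(t \in [set: T]) F t != 0 ->
  exists t, F t != 0.
Proof.
by move=> /(@fsbigN1 _ _ _ unit T [set: T] (fun _ t => F t) tt)[t _ Ft]; exists t.
Qed.

End FiniteSupportSums.

Section Products.
Local Open Scope ring_scope.
Variables (K : fieldType) (X : choiceType).
Implicit Types a b c : X -> X -> K.

Definition mmul a b : X -> X -> K :=
  fun x y => \sum_(z \in [set: X]) a x z * b z y.

Lemma mmul_neq0 a b x y : mmul a b x y != 0 ->
  exists2 z, a x z != 0 & b z y != 0.
Proof. by move=> /fsum_neq0[z]; rewrite mulf_eq0 negb_or => /andP[]; exists z. Qed.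

Lemma mmul_eq0 a b x y : (forall z, a x z != 0 -> b z y != 0 -> False) ->
  mmul a b x y = 0.
Proof.
move=> ab; apply/eqP; apply/negPn/negP => /mmul_neq0[z az bz].
exact: (ab z).
Qed.

Lemma mmulDl a a' b : CFM b -> mmul (a + a') b = mmul a b + mmul a' b.
Proof.
move=> cb; apply/funext => x; apply/funext => y.
rewrite /mmul !fctE -(fsum_add (cb y)).
- by apply: eq_fsbigr => z _; rewrite mulrDl.
- by move=> z /negP; rewrite negbK => /eqP ->; rewrite mulr0.
- by move=> z /negP; rewrite negbK => /eqP ->; rewrite mulr0.
Qed.

Lemma mmulDr a b b' : CFM b -> CFM b' -> mmul a (b + b') = mmul a b + mmul a b'.
Proof.
move=> cb cb'; apply/funext => x; apply/funext => y.
have fD : finite_set ([set z | b z y != 0] `|` [set z | b' z y != 0]).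
  by rewrite finite_setU.
rewrite /mmul !fctE -(fsum_add fD).
- by apply: eq_fsbigr => z _; rewrite mulrDr.
- by move=> z /not_orP[/negP]; rewrite negbK => /eqP ->; rewrite mulr0.
- by move=> z /not_orP[_ /negP]; rewrite negbK => /eqP ->; rewrite mulr0.
Qed.

Lemma mx_neq0 a : a <> 0 -> exists x y, a x y != 0.
Proof.
move=> a0; apply: contrapT => none; apply: a0.
apply/funext => x; apply/funext => y; apply/eqP; apply/negPn/negP => nz.
by apply: none; exists x, y.
Qed.

Lemma CFM_add a b : CFM a -> CFM b -> CFM (a + b).
Proof.
move=> ca cb y; have fU : finite_set ([set x | a x y != 0] `|` [set x | b x y != 0]).
  by rewrite finite_setU.
apply: sub_finite_set fU => x /=; rewrite !fctE.
have [->|] := eqVneq (a x y) 0; last by left.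
by rewrite add0r; right.
Qed.

End Products.

(** * The subalgebras H(I,i) *)

Section Blocks.
Local Open Scope ring_scope.
Variables (aleph : pointedType) (K : fieldType).
Variables (d : Order.disp_t) (I : porderType d).
Local Notation X := (@Xidx aleph d I).
Local Notation V := (X -> X -> K).
Implicit Types (x y z w : X) (i j k : I) (m n : V).

Definition regular i m := forall x y x' y', sim i x y -> sim i x' y' ->
  same i x x' -> same i y y' -> m x y = m x' y'.

(** Weaker than [supported]: entries whose row and column both avoid [i] are left free. Elements of
    H(I,j) with [i <= j] satisfy it, and with [regular] it suffices for multiplying blocks at [i] on
    the right. *)
Definition compatible i m := forall x y, m x y != 0 ->
  Xchain x i \/ Xchain y i -> sim i x y.

Definition supported i m := forall x y, m x y != 0 -> sim i x y.

(** Rows are counted up to [same i], since [psi] repeats each row of its argument in every [sim i]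
    class. *)
Definition rows_in i (Z : set X) m :=
  forall x y, m x y != 0 -> exists2 z, Z z & same i x z.

(* The image under psi i of the matrices whose nonzero rows are restrictions
   of elements of Z. *)
Definition block i Z m := [/\ supported i m, regular i m & rows_in i Z m].

Definition unit_at i : V := fun x y => (`[< x = y /\ Xchain x i >])%:R.

Lemma glue_fun i x : Xchain x i -> exists g : X -> X,
  forall y, Xchain y i -> sim i (g y) x /\ same i (g y) y.
Proof.
move=> xi.
suff /choice[g gP] : forall y, exists w, Xchain y i -> sim i w x /\ same i w y.
  by exists g.
move=> y; have [yi|nyi] := pselect (Xchain y i); last by exists y.
by have [w wx wy] := Xglue xi yi; exists w.
Qed.

Lemma psi_sim i (a : @Xidx aleph d (upset i) -> @Xidx aleph d (upset i) -> K)
    x y (xi : Xchain x i) (yi : Xchain y i) :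
  sim i x y -> psi a x y = a (Xrestrict xi) (Xrestrict yi).
Proof.
move=> [_ _ c]; rewrite /psi; case: pselect => // xi'; case: pselect => // yi'.
by rewrite asboolT // (Prop_irrelevance xi' xi) (Prop_irrelevance yi' yi).
Qed.

Lemma psi_nsim i (a : @Xidx aleph d (upset i) -> @Xidx aleph d (upset i) -> K) x y :
  ~ sim i x y -> psi a x y = 0.
Proof.
move=> ns; rewrite /psi; case: pselect => // xi'; case: pselect => // yi'.
by case: asboolP => // c; case: ns.
Qed.

Lemma psi_one i : psi (@mx_one K (@Xidx aleph d (upset i))) = unit_at i.
Proof.
apply/funext => x; apply/funext => y; rewrite /unit_at.
have [s|ns] := pselect (sim i x y); last first.
  by rewrite psi_nsim // asboolF // => -[xy xi]; apply: ns; rewrite -xy; apply: sim_refl.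
have [xi yi _] := s; rewrite (psi_sim _ xi yi s) /mx_one; congr _%:R.
congr nat_of_bool; apply/eqP/asboolP => [/XrestrictP/(sim_same_eq s)//|[xy _]].
by apply/XrestrictP; rewrite -xy; apply: same_refl.
Qed.

Lemma psi_FR_block i a : FR a ->
  exists2 Z, finite_set Z & block i Z (@psi aleph K d I i a).
Proof.
move=> [_ fa]; have [z0 z0i] := Xidx_mem aleph i.
have [l lP] := choice (fun u => @glue_up aleph d I i z0 u z0i).
exists (l @` [set u | exists v, a u v != 0]); first exact: finite_image.
have supp : supported i (psi a).
  move=> x y; apply: contraNP => /psi_nsim ->; exact: eqxx.
split=> //.
  move=> x y x' y' s s' xx' yy'.
  have [xi yi _] := s; have [xi' yi' _] := s'.
  rewrite (psi_sim _ xi yi s) (psi_sim _ xi' yi' s').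
  by congr a; apply/XrestrictP.
move=> x y nz; have s := supp _ _ nz; have [xi yi _] := s.
rewrite (psi_sim _ xi yi s) in nz.
exists (l (Xrestrict xi)); first by exists (Xrestrict xi) => //; exists (Xrestrict yi).
by have [li [lE _]] := lP (Xrestrict xi); apply/(XrestrictP xi li).
Qed.

Lemma block_psi_FR i Z m : finite_set Z -> block i Z m ->
  exists2 a, FR a & m = @psi aleph K d I i a.
Proof.
move=> fZ [supp reg few]; have [z0 z0i] := Xidx_mem aleph i.
have [g gP] := choice (fun u => @glue_up aleph d I i z0 u z0i).
pose r z := match pselect (Xchain z i) with
  left h => Xrestrict h | right _ => Xrestrict z0i end.
have fin : finite_set [set u | exists v, m (g u) (g v) != 0].
  apply: (@sub_finite_set _ _ (r @` Z)); last exact: finite_image.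
  move=> u [v /few[z Zz sz]]; exists z => //.
  rewrite /r; case: pselect => [zi|]; last by case: sz.
  by have [gi [<- _]] := gP u; apply/XrestrictP/same_sym.
(* The block is read off in the [sim i] class of the base index [z0]; by regularity any other class
   would give the same block. *)
exists (fun u v => m (g u) (g v)).
  split=> // v; apply: sub_finite_set fin => u nz; by exists v.
apply/funext => x; apply/funext => y.
have [s|ns] := pselect (sim i x y); last first.
  by rewrite psi_nsim //; apply/eqP; apply/negPn/negP => /supp.
have [xi yi _] := s; rewrite (psi_sim _ xi yi s).
have [gxi [gx sx]] := gP (Xrestrict xi); have [gyi [gy sy]] := gP (Xrestrict yi).
apply: reg => //.
- exact: sim_trans sx (sim_sym sy).
- exact/XrestrictP/esym.
- exact/XrestrictP/esym.
Qed.

Lemma H1P i m : H1 i m <->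
  (~ is_maximal i /\ exists2 Z, finite_set Z & block i Z m) \/
  (is_maximal i /\ exists c, m = fun x y => c * unit_at i x y).
Proof.
rewrite /H1 psi_one; split=> -[[mi h]|]; [left|by right|left|by right]; split=> //.
  by case: h => a /psi_FR_block ha ->.
by case: h => Z fZ /(block_psi_FR fZ).
Qed.

Lemma unit_at_neq0 i x y (c : K) : c * unit_at i x y != 0 -> x = y /\ Xchain x i.
Proof. by rewrite /unit_at; case: asboolP => //; rewrite mulr0 eqxx. Qed.

Lemma unit_at_regular i (c : K) : regular i (fun x y => c * unit_at i x y).
Proof.
move=> x y x' y' s s' xx' yy'; congr (_ * _); rewrite /unit_at; congr _%:R.
have [xi _ _] := s; have [xi' _ _] := s'.
congr nat_of_bool; apply/asboolP/asboolP => -[e _]; split=> //.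
  apply: (sim_same_eq s'); rewrite -e in yy'.
  exact: same_trans (same_sym xx') yy'.
apply: (sim_same_eq s); rewrite -e in yy'.
exact: same_trans xx' (same_sym yy').
Qed.

Lemma H1_supported i m : H1 i m -> supported i m.
Proof.
move=> /H1P[[_ [Z _ []//]]|[_ [c ->]]] x y /unit_at_neq0[<- xi].
exact: sim_refl.
Qed.

Lemma H1_regular i m : H1 i m -> regular i m.
Proof. by move=> /H1P[[_ [Z _ []//]]|[_ [c ->]]]; apply: unit_at_regular. Qed.

(** The nonzero rows of column [y] lie in the [sim i] class of [y], which contains only one index
    for each restriction coming from [Z]. *)
Lemma block_column_finite i Z m : finite_set Z -> block i Z m -> CFM m.
Proof.
move=> fZ [supp _ few] y.
have [yi|nyi] := pselect (Xchain y i); last first.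
  by apply: sub_finite_set (finite_set0 X) => x /supp[].
have [g gP] := glue_fun yi.
apply: (@sub_finite_set _ _ (g @` Z)); last exact: finite_image.
move=> x nz; have [z Zz xz] := few _ _ nz; exists z => //.
have [_ zi _ _] := xz; have [gy gz] := gP z zi.
apply: (@sim_same_eq _ _ _ i).
  exact: sim_trans gy (sim_sym (supp _ _ nz)).
exact: same_trans gz (same_sym xz).
Qed.

Lemma H1_CFM i m : H1 i m -> CFM m.
Proof.
move=> /H1P[[_ [Z fZ /block_column_finite]]|[_ [c ->]] y]; first exact.
by apply: sub_finite_set (finite_set1 y) => x /unit_at_neq0[].
Qed.

Lemma H1_compatible i j m : (i <= j)%O -> H1 j m -> compatible i m.
Proof.
move=> ij /H1_supported supp x y /supp s [xi|yi]; first exact: sim_le s.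
by apply: sim_sym; apply: sim_le (sim_sym s).
Qed.

(** By [sim_transfer] the two entries lie both inside or both outside the [sim j] classes: inside,
    regularity at [j] applies; outside, both vanish. *)
Lemma H1_regular_le i j m : (i <= j)%O -> H1 j m -> regular i m.
Proof.
move=> ij Hm x y x' y' s s' xx' yy'.
have [sj|nsj] := pselect (sim j x y).
  have sj' := sim_transfer ij s s' xx' yy' sj.
  have [xj yj _] := sj.
  by apply: (H1_regular Hm) => //; apply: same_le ij _ _.
have nsj' : ~ sim j x' y'.
  by move=> sj'; apply: nsj;
    apply: (sim_transfer ij s' s (same_sym xx') (same_sym yy')).
have [/eqP -> |/(H1_supported Hm)//] := boolP (m x y == 0).
by have [/eqP -> |/(H1_supported Hm)//] := boolP (m x' y' == 0).
Qed.

(** The inner index runs over the [sim i] class of the row. Gluing gives a bijection from the class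
    of [x'] onto that of [x] which preserves restrictions to {i <=} and therefore matches the terms
    of the two sums. *)
Lemma mmul_regular i m n : compatible i m -> compatible i n ->
  regular i m -> regular i n -> regular i (mmul m n).
Proof.
move=> cm cn rm rn x y x' y' s s' xx' yy'.
have [xi yi _] := s; have [xi' yi' _] := s'.
have [g gP] := glue_fun xi.
have sx'x t : sim i x' t -> sim i x (g t).
  by move=> [_ ti _]; apply: sim_sym; case: (gP _ ti).
have sy t : sim i x' t -> sim i t y'.
  by move=> /sim_sym st; apply: sim_trans st s'.
apply: (@fsum_bij _ _ _ _ [set t | sim i x' t] [set t | sim i x t] g).
- split.
  + by move=> t /sx'x.
  + move=> t u /set_mem st /set_mem su tu.
    have [_ ti _] := st; have [_ ui _] := su.
    apply: (@sim_same_eq _ _ _ i); first exact: sim_trans (sim_sym st) su.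
    have [_ gt] := gP _ ti; have [_ gu] := gP _ ui.
    by apply: same_trans (same_sym gt) _; rewrite tu.
  + move=> u su; have [_ ui _] := su.
    have [t tx tu] := Xglue xi' ui; exists t; first exact: sim_sym.
    have [ti _ _] := tx; have [gx gt] := gP _ ti.
    apply: (@sim_same_eq _ _ _ i); first exact: sim_trans gx su.
    exact: same_trans gt tu.
- move=> t nst; have [/eqP -> |/cm h] := boolP (m x t == 0); first by rewrite mul0r.
  by case: nst; apply: h; left.
- move=> t nst; have [/eqP -> |/cm h] := boolP (m x' t == 0); first by rewrite mul0r.
  by case: nst; apply: h; left.
- move=> t st; have [_ ti _] := st; have [gx gt] := gP _ ti.
  congr (_ * _); first by apply: rm => //; apply: sx'x.
  by apply: rn => //; [apply: sim_trans gx s|apply: sy].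
Qed.

Lemma block_mulr i Z m n : block i Z m -> compatible i n -> regular i n ->
  block i Z (mmul m n).
Proof.
move=> [sm rm fm] cn rn; split.
- move=> x y /mmul_neq0[z /sm s]; have [_ zi _] := s.
  by move=> /cn -/(_ (or_introl zi)); apply: sim_trans.
- by apply: mmul_regular => // x y /sm.
- by move=> x y /mmul_neq0[z /fm].
Qed.

(** Up to [same i], the nonzero rows of the product come from the nonzero entries of the columns of
    [n] indexed by [Z]; column-finiteness of [n] makes them finite in number. *)
Lemma block_mull i Z m n : finite_set Z -> block i Z m -> CFM n ->
  compatible i n -> regular i n ->
  exists2 Z', finite_set Z' & block i Z' (mmul n m).
Proof.
move=> fZ [sm rm fm] cfn cn rn.
exists (\bigcup_(z in Z) [set x | n x z != 0]); first exact: bigcup_finite.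
split.
- move=> x y /mmul_neq0[z + /sm s]; have [zi _ _] := s.
  by move=> /cn -/(_ (or_intror zi)) h; apply: sim_trans s.
- by apply: mmul_regular => // x y /sm.
- move=> x y /mmul_neq0[t nt mt]; have st := sm _ _ mt; have [ti _ _] := st.
  have [z Zz tz] := fm _ _ mt; have xt := cn _ _ nt (or_intror ti).
  have [xi _ _] := xt; have [_ zi _ _] := tz.
  (* Moving row [x] into the class of [z] turns the entry of [n] at [x], [t] into an entry of column
     [z], with the same value by regularity. *)
  have [x0 x0z x0x] := Xglue zi xi; exists x0; last exact: same_sym.
  exists z => //=; rewrite (rn x0 z x t) //.
  exact: same_sym.
Qed.

Lemma not_maximal_lt i j : (i < j)%O -> ~ is_maximal i.
Proof. by rewrite lt_neqAle => /andP[/eqP ij /[swap] /[apply] /esym]. Qed.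

Lemma H1_nonmax i m : ~ is_maximal i -> H1 i m -> exists2 Z, finite_set Z & block i Z m.
Proof. by move=> nm /H1P[[]//|[]]. Qed.

Lemma mmul_unit_at i (a b : K) :
  mmul (fun x y => a * unit_at i x y) (fun x y => b * unit_at i x y) =
  fun x y => (a * b) * unit_at i x y.
Proof.
apply/funext => x; apply/funext => y.
rewrite /mmul (fsum_single (z := x)).
  have [xi|xi] := pselect (Xchain x i).
    by rewrite /unit_at asboolT // mulr1 mulrA.
  by rewrite /unit_at asboolF ?mulr0 ?mul0r ?asboolF ?mulr0 // => -[].
move=> t tx; have [/eqP ->|/unit_at_neq0[xt]] := boolP (a * unit_at i x t == 0).
  by rewrite mul0r.
by case: tx.
Qed.

Lemma H1_mul i m n : H1 i m -> H1 i n -> H1 i (mmul m n).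
Proof.
move=> Hm Hn; have [mi|nmi] := pselect (is_maximal i).
  move: Hm Hn => /H1P[[]//|[_ [a ->]]] /H1P[[]//|[_ [b ->]]].
  by apply/H1P; right; split=> //; exists (a * b); apply: mmul_unit_at.
have [Z fZ bm] := H1_nonmax nmi Hm.
apply/H1P; left; split=> //; exists Z => //; apply: block_mulr => //.
  exact: H1_compatible Hn.
exact: H1_regular.
Qed.

Lemma H1_mulr_lt i j m n : (i < j)%O -> H1 i m -> H1 j n -> H1 i (mmul m n).
Proof.
move=> ij Hm Hn; have nmi := not_maximal_lt ij.
have [Z fZ bm] := H1_nonmax nmi Hm.
apply/H1P; left; split=> //; exists Z => //; apply: block_mulr => //.
  exact: H1_compatible (ltW ij) Hn.
exact: H1_regular_le (ltW ij) Hn.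
Qed.

Lemma H1_mull_lt i j m n : (i < j)%O -> H1 i m -> H1 j n -> H1 i (mmul n m).
Proof.
move=> ij Hm Hn; have nmi := not_maximal_lt ij.
have [Z fZ bm] := H1_nonmax nmi Hm.
apply/H1P; left; split=> //; apply: block_mull fZ bm _ _ _.
- exact: H1_CFM Hn.
- exact: H1_compatible (ltW ij) Hn.
- exact: H1_regular_le (ltW ij) Hn.
Qed.

(** A nonzero term would have an inner index whose chain contains both [i] and [j]. *)
Lemma H1_mul_incomparable i j m n : ~~ (i <= j)%O -> ~~ (j <= i)%O ->
  H1 i m -> H1 j n -> mmul m n = 0.
Proof.
move=> ij ji Hm Hn; apply/funext => x; apply/funext => y; apply: mmul_eq0.
move=> z /(H1_supported Hm)[_ zi _] /(H1_supported Hn)[zj _ _].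
by case: (Xchain_total zi zj) => h; [rewrite h in ij|rewrite h in ji].
Qed.

Lemma H1_0 i : H1 i (0 : V).
Proof.
apply/H1P; have [mi|nmi] := pselect (is_maximal i); [right|left]; split=> //.
  by exists 0; apply/funext => x; apply/funext => y; rewrite mul0r.
by exists set0 => //; split=> [x y|//|x y]; rewrite /= eqxx.
Qed.

Lemma block_opp i Z m : block i Z m -> block i Z (- m).
Proof.
move=> [sm rm fm]; split=> [x y|x y x' y' s s' xx' yy'|x y].
- by rewrite !fctE oppr_eq0; apply: sm.
- by rewrite !fctE (rm _ _ _ _ s s' xx' yy').
- by rewrite !fctE oppr_eq0; apply: fm.
Qed.

Lemma block_add i Z Z' m n : block i Z m -> block i Z' n ->
  block i (Z `|` Z') (m + n).
Proof.
move=> [sm rm fm] [sn rn fn].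
have sum0 x y : (m + n) x y != 0 -> m x y != 0 \/ n x y != 0.
  rewrite !fctE; have [->|] := eqVneq (m x y) 0; last by left.
  by rewrite add0r; right.
split=> [x y /sum0[/sm|/sn]//|x y x' y' s s' xx' yy'|x y /sum0[/fm|/fn]].
- by rewrite !fctE (rm _ _ _ _ s s' xx' yy') (rn _ _ _ _ s s' xx' yy').
- by move=> [z Zz xz]; exists z => //; left.
- by move=> [z Zz xz]; exists z => //; right.
Qed.

Lemma H1_opp i m : H1 i m -> H1 i (- m).
Proof.
move=> /H1P[[nm [Z fZ Bm]]|[mi [c ->]]]; apply/H1P; [left|right]; split=> //.
  by exists Z => //; apply: block_opp.
by exists (- c); apply/funext => x; apply/funext => y; rewrite !fctE mulNr.
Qed.

Lemma H1_add i m n : H1 i m -> H1 i n -> H1 i (m + n).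
Proof.
have [mi|nmi] := pselect (is_maximal i).
  move=> /H1P[[]//|[_ [a ->]]] /H1P[[]//|[_ [b ->]]].
  apply/H1P; right; split=> //; exists (a + b).
  by apply/funext => x; apply/funext => y; rewrite !fctE mulrDl.
move=> /(H1_nonmax nmi)[Z fZ Bm] /(H1_nonmax nmi)[Z' fZ' Bn].
apply/H1P; left; split=> //; exists (Z `|` Z'); first by rewrite finite_setU.
exact: block_add.
Qed.

End Blocks.

(** * Directness and multiplication *)

Lemma seq_maximal_above d (I : porderType d) (s : seq I) (P : set I) i0 :
  i0 \in s -> P i0 -> exists j, [/\ j \in s, P j, (i0 <= j)%O &
    forall i, i \in s -> P i -> ~~ (j < i)%O].
Proof.
have [n] := ubnP (size [seq k <- s | (i0 < k)%O]).
elim: n i0 => // n IH i0; rewrite ltnS => sz s0 P0.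
have [[i [si Pi i0i]]|none] := pselect (exists i, [/\ i \in s, P i & (i0 < i)%O]).
  have [|//|//|j [sj Pj ij jmax]] := IH i.
    apply: leq_trans sz; set t := [seq k <- s | (i0 < k)%O].
    have -> : [seq k <- s | (i < k)%O] = [seq k <- t | (i < k)%O].
      rewrite -filter_predI; apply: eq_filter => k /=.
      by have [ik|] := boolP (i < k)%O; rewrite //= (lt_trans i0i ik).
    rewrite size_filter ltn_neqAle count_size andbT -all_count.
    by apply/allPn; exists i; rewrite ?mem_filter ?i0i ?ltxx.
  by exists j; split=> //; apply: le_trans (ltW i0i) ij.
exists i0; split=> // i si Pi; apply/negP => i0i.
by apply: none; exists i.
Qed.

Section Decomposition.
Local Open Scope ring_scope.
Variables (aleph : pointedType) (K : fieldType).
Variables (d : Order.disp_t) (I : porderType d).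
Hypothesis aleph_infinite : infinite_set [set: aleph].
Local Notation X := (@Xidx aleph d I).
Local Notation V := (X -> X -> K).
Local Notation HJ J := (rng_set (H aleph K J) : set V).
Implicit Types (J L : set I) (s : seq I) (x y z w : X) (i j k : I) (a b : V).

Lemma aleph_fresh (A : set aleph) : finite_set A -> exists c, ~ A c.
Proof.
move=> fA; apply: contrapT => /forallNP h; apply: aleph_infinite.
by apply: sub_finite_set fA => c _; apply: contrapT; apply: h.
Qed.

(* Above a nonzero entry of the component at a maximal j one finds an entry of
   the sum, at a row whose value at each i < j avoids the finitely many nonzero
   rows of the component at i, so that only the component at j contributes. *)
Lemma sum_entry_neq0 s (m : I -> V) j k : uniq s -> j \in s ->
  (forall i, i \in s -> H1 i (m i)) -> m j <> 0 ->
  (forall i, i \in s -> (j < i)%O -> m i = 0) -> (k <= j)%O ->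
  exists x y, Xchain y k /\ (\sum_(i <- s) m i) x y != 0.
Proof.
move=> us sj Hm mj0 mgt kj.
have [x0 [y0 nz]] := mx_neq0 mj0.
have s0 := H1_supported (Hm _ sj) nz; have [x0j y0j _] := s0.
have [B mB kB] : exists2 B, maximal_chain B &
    (k |` (Xchain x0 `&` [set l | (j <= l)%O])) `<=` B.
  apply: maximal_chain_extend => u v [->|[xu ju]] [->|[xv jv]].
  - by left.
  - by left; apply: le_trans kj jv.
  - by right; apply: le_trans kj ju.
  - exact: Xchain_total xu xv.
have Bj : B j by apply: kB; right; split=> //=.
have hZ i : exists Z : set X, finite_set Z /\
    ((i \in s) -> (i < j)%O -> rows_in i Z (m i)).
  have [si|] := boolP (i \in s); last by exists set0.
  have [ij|] := boolP (i < j)%O; last by exists set0.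
  have [Z fZ [_ _ rZ]] := H1_nonmax (not_maximal_lt ij) (Hm _ si).
  by exists Z.
have [Z ZP] := choice hZ.
have [c nc] : exists c, ~ (\bigcup_(i in [set` s]) ((fun z : X => Xfun z i) @` Z i)) c.
  apply: aleph_fresh; apply: bigcup_finite => // i _.
  by apply: finite_image; case: (ZP i).
pose p i := if i \in s then c else (point : aleph).
have fp : finite_set [set i | p i != point].
  apply: (@sub_finite_set _ _ [set` s]) => // i /=; rewrite /p.
  by case: ifP; rewrite ?eqxx.
pose z := MkXidx fp mB.
(* The restrictions of [x0] and [y0] to {j <=} are kept, so the entry of [m j] is unchanged;
   elsewhere the data come from [z], whose value is the fresh [c] at each member of [s]. *)
have [x xz xx0] := @Xglue _ _ _ j z x0 Bj x0j.
have [y yz yy0] := @Xglue _ _ _ j z y0 Bj y0j.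
have xy := sim_trans xz (sim_sym yz).
exists x, y; split.
  by move/simP: yz => [_ _ h _]; apply/(h _ kj); apply: kB; left.
rewrite fct_sumE fct_sumE (bigD1_seq j) //= big_seq_cond big1 ?addr0.
  by rewrite (H1_regular (Hm _ sj) xy s0).
move=> i /andP[si ij]; apply/eqP; apply/negPn/negP => mi.
have [xi _ _] := H1_supported (Hm _ si) mi.
have [xj _ _] := xy.
have [|ji] := Xchain_total xi xj; last first.
  have jlt : (j < i)%O by rewrite lt_neqAle eq_sym ij.
  by move: mi; rewrite mgt // eqxx.
rewrite le_eqVlt (negbTE ij) /= => ilt.
have [_ /(_ si ilt) rZ] := ZP i.
have [w Zw [_ _ _ f]] := rZ _ _ mi.
apply: nc; exists i => //; exists w => //.
rewrite -f //; move/simP: xz => [_ _ _ ->] /=; last by rewrite lt_geF.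
by rewrite /p si.
Qed.

(** For [y] through [i], this is [psi i] of the diagonal matrix unit at the restriction of [y].
    Multiplying by it on the right preserves column [y]. *)
Definition row_unit i y : V := fun t z => (`[< t = z /\ same i t y >])%:R.

Lemma row_unit_neq0 i y t z : row_unit i y t z != 0 -> t = z /\ same i t y.
Proof. by rewrite /row_unit; case: asboolP => //; rewrite eqxx. Qed.

Lemma row_unit_block i y : block i [set y] (row_unit i y).
Proof.
split.
- by move=> t z /row_unit_neq0[<- [ti _ _ _]]; apply: sim_refl.
- move=> t z t' z' s s' tt' zz'; rewrite /row_unit; congr _%:R.
  congr nat_of_bool; apply/asboolP/asboolP => -[e ty].
    split; last exact: same_trans (same_sym tt') ty.
    apply: (sim_same_eq s'); rewrite -e in zz'.
    exact: same_trans (same_sym tt') zz'.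
  split; last exact: same_trans tt' ty.
  apply: (sim_same_eq s); rewrite -e in zz'.
  exact: same_trans tt' (same_sym zz').
- by move=> t z /row_unit_neq0[_ ty]; exists y.
Qed.

Lemma row_unit_diag i y : Xchain y i -> row_unit i y y y = 1.
Proof. by move=> yi; rewrite /row_unit asboolT //; split=> //; apply: same_refl. Qed.

Lemma row_unit_H1 i y : ~ is_maximal i -> H1 i (row_unit i y).
Proof.
move=> nm; apply/H1P; left; split=> //; exists [set y] => //.
exact: row_unit_block.
Qed.

Lemma mmul_row_unit i a x y : Xchain y i -> mmul a (row_unit i y) x y = a x y.
Proof.
move=> yi; rewrite /mmul (fsum_single (z := y)); first by rewrite row_unit_diag // mulr1.
move=> t ty; have [/eqP ->|/row_unit_neq0[]//] := boolP (row_unit i y t y == 0).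
by rewrite mulr0.
Qed.

Lemma H1_nontrivial i : exists2 a : V, H1 i a & a <> 0.
Proof.
have [x xi] := Xidx_mem aleph i.
have [mi|nmi] := pselect (is_maximal i).
  exists (fun x y => 1 * unit_at K i x y).
    by apply/H1P; right; split=> //; exists 1.
  move=> /(congr1 (fun a : V => a x x)) /=; rewrite /unit_at asboolT // mulr1.
  by apply/eqP; exact: oner_neq0.
exists (row_unit i x); first exact: row_unit_H1.
move=> /(congr1 (fun a : V => a x x)) /=; rewrite row_unit_diag //.
by apply/eqP; exact: oner_neq0.
Qed.

Lemma HJ_0 J : HJ J 0.
Proof. by exists 0%N, (fun=> 0); split=> [[]//|]; rewrite big_ord0. Qed.

Lemma HJ_add J a b : HJ J a -> HJ J b -> HJ J (a + b).
Proof.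
move=> [n [f [fP ->]]] [n' [f' [fP' ->]]].
exists (n + n')%N, (fun l => match fintype.split l with inl u => f u | inr u => f' u end).
split=> [l|]; first by case: fintype.split.
change (\sum_(l < n) f l + \sum_(l < n') f' l =
  \sum_(l < n + n') (match fintype.split l with inl u => f u | inr u => f' u end)).
rewrite big_split_ord /=; congr (_ + _); apply: eq_bigr => l _.
  by case: split_ordP => u; [move=> /lshift_inj ->|move/eqP; rewrite eq_lrshift].
by case: split_ordP => u; [move/eqP; rewrite eq_rlshift|move=> /rshift_inj ->].
Qed.

Lemma HJ_H1 J j a : J j -> H1 j a -> HJ J a.
Proof.
move=> Jj Ha; exists 1%N, (fun=> a); split=> [_|]; first by exists (H1 j) => //; exists j.
by change (a = \sum_(l < 1) a); rewrite big_ord1.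
Qed.

Lemma HJ_ind J (P : V -> Prop) : P 0 -> (forall a b, P a -> P b -> P (a + b)) ->
  (forall j a, J j -> H1 j a -> P a) -> forall a, HJ J a -> P a.
Proof.
move=> P0 Padd PH _ [n [f [fP ->]]].
change (P (\sum_(l < n) f l)); apply: big_ind => // l _.
by have [_ [j Jj <-]] := fP l; apply: PH.
Qed.

Lemma HJ_opp J a : HJ J a -> HJ J (- a).
Proof.
move: a; apply: HJ_ind.
- by rewrite oppr0; apply: HJ_0.
- by move=> a b Ha Hb; rewrite opprD; apply: HJ_add.
- by move=> j a Jj Ha; apply: (HJ_H1 Jj); apply: H1_opp.
Qed.

Lemma HJ_sub J L : J `<=` L -> HJ J `<=` HJ L.
Proof.
move=> JL; apply: HJ_ind; [exact: HJ_0|exact: HJ_add|].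
by move=> j a /JL; apply: HJ_H1.
Qed.

Lemma HJ_CFM J a : HJ J a -> CFM a.
Proof.
move: a; apply: HJ_ind; [|exact: CFM_add|by move=> j a _; apply: H1_CFM].
by move=> y; apply: sub_finite_set (finite_set0 X) => x; rewrite /= eqxx.
Qed.

Lemma mmul0l b : mmul (0 : V) b = 0.
Proof. by apply/funext => x; apply/funext => y; apply: mmul_eq0 => z; rewrite eqxx. Qed.

Lemma mmul0r a : mmul a (0 : V) = 0.
Proof. by apply/funext => x; apply/funext => y; apply: mmul_eq0 => z _; rewrite eqxx. Qed.

(** Three index sets cover at once the closure of H(I,J) under products, the ideals given by lower
    sets, and multiplication by elements of a single H(I,k). *)
Lemma HJ_mul J1 J2 J3 a b :
  (forall i j, J1 i -> J2 j -> ((i <= j)%O -> J3 i) /\ ((j <= i)%O -> J3 j)) ->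
  HJ J1 a -> HJ J2 b -> HJ J3 (mmul a b).
Proof.
move=> J123 Ha; move: b.
(* Column-finiteness is carried through the induction because [mmulDr] requires it of both
   summands. *)
suff h b : HJ J2 b -> CFM b /\ HJ J3 (mmul a b) by move=> b /h[].
move: b; apply: HJ_ind.
- by rewrite mmul0r; split; [apply: (@HJ_CFM J1); apply: HJ_0|apply: HJ_0].
- move=> b b' [cb Hb] [cb' Hb']; split; first exact: CFM_add.
  by rewrite mmulDr //; apply: HJ_add.
- move=> j b Jj Hb; have cb := H1_CFM Hb; split=> //.
  move: a Ha; apply: HJ_ind.
  + by rewrite mmul0l; apply: HJ_0.
  + by move=> a a' Ha Ha'; rewrite mmulDl //; apply: HJ_add.
  + move=> i a Ji Ha; have [h1 h2] := J123 _ _ Ji Jj.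
    have [ij|nij] := boolP (i <= j)%O; last first.
      have [ji|nji] := boolP (j <= i)%O; last first.
        by rewrite (H1_mul_incomparable nij nji Ha Hb); apply: HJ_0.
      apply: HJ_H1 (h2 ji) _; apply: (@H1_mull_lt _ _ _ _ j i) => //.
      by rewrite lt_leAnge ji.
    apply: HJ_H1 (h1 ij) _; move: ij; rewrite le_eqVlt => /orP[/eqP ij|ij].
      by apply: H1_mul => //; rewrite ij.
    exact: H1_mulr_lt ij Ha Hb.
Qed.

Definition decomposes J s (m : I -> V) a :=
  [/\ uniq s, forall i, m i <> 0 -> J i /\ i \in s, forall i, H1 i (m i)
    & a = \sum_(i <- s) m i].

Lemma big_uniq_widen s s' (m : I -> V) : uniq s -> uniq s' ->
  {subset s <= s'} -> (forall i, m i <> 0 -> i \in s) ->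
  \sum_(i <- s) m i = \sum_(i <- s') m i.
Proof.
move=> us us' ss' ms; rewrite [LHS]fsbig_seq // [RHS]fsbig_seq //.
apply: fsbig_widen => [i /=|i [_ ni]]; first exact: ss'.
by apply: contrapT => mi; apply: ni; apply: ms.
Qed.

Lemma HJ_decomposes J a : HJ J a -> exists s m, decomposes J s m a.
Proof.
move: a; apply: HJ_ind.
- exists [::], (fun=> 0); split=> // [i|]; [exact: H1_0|by rewrite big_nil].
- move=> a b [s [m [us ms Hm ->]]] [t [n [ut nt Hn ->]]].
  exists (undup (s ++ t)), (fun i => m i + n i); split.
  + exact: undup_uniq.
  + move=> i mn; rewrite mem_undup mem_cat.
    have [m0|/ms[? ->]//] := pselect (m i = 0).
    have [n0|/nt[? ->]] := pselect (n i = 0); last by rewrite orbT.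
    by case: mn; rewrite m0 n0 addr0.
  + by move=> i; apply: H1_add.
  + rewrite big_split /=; congr (_ + _); apply: big_uniq_widen; rewrite ?undup_uniq //.
    * by move=> i si; rewrite mem_undup mem_cat si.
    * by move=> i /ms[].
    * by move=> i ti; rewrite mem_undup mem_cat ti orbT.
    * by move=> i /nt[].
- move=> j a Jj Ha; exists [:: j], (fun i => if i == j then a else 0); split=> //.
  + by move=> i; case: eqP => // -> _; rewrite inE eqxx.
  + by move=> i; case: eqP => [->//|_]; apply: H1_0.
  + by rewrite big_seq1 eqxx.
Qed.

(** Otherwise take a maximal index of the support of [m - n]: [sum_entry_neq0] yields a nonzero
    entry of the sum of all differences, which is [a - a]. *)
Lemma decomposes_unique J L s t m n a :
  decomposes J s m a -> decomposes L t n a -> forall i, m i = n i.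
Proof.
move=> [us ms Hm aE] [ut nt Hn aE'] i.
apply: contrapT => /eqP; rewrite -subr_eq0 => /eqP mni.
pose r := undup (s ++ t); have ur : uniq r := undup_uniq _.
have supp l : m l - n l <> 0 -> l \in r.
  rewrite mem_undup mem_cat; have [m0|/ms[_ ->]//] := pselect (m l = 0).
  have [n0|/nt[_ ->]] := pselect (n l = 0); last by rewrite orbT.
  by rewrite m0 n0 subr0.
have [j [rj mnj _ jmax]] :=
  seq_maximal_above (P := [set l | m l - n l <> 0]) (supp _ mni) mni.
have [||||x [y [_]]] := @sum_entry_neq0 r (fun l => m l - n l) j j ur rj.
- by move=> l _; apply: H1_add => //; apply: H1_opp.
- by [].
- move=> l rl jl; apply: contrapT => mnl.
  by have := jmax l rl mnl; rewrite jl.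
- exact: lexx.
rewrite sumrB -(@big_uniq_widen s r) //; last 2 first.
- by move=> l sl; rewrite mem_undup mem_cat sl.
- by move=> l /ms[].
rewrite -(@big_uniq_widen t r) //; last 2 first.
- by move=> l tl; rewrite mem_undup mem_cat tl orbT.
- by move=> l /nt[].
by rewrite -aE -aE' subrr eqxx.
Qed.

Lemma decomposes_HJ J L s m a i : decomposes J s m a -> HJ L a ->
  m i <> 0 -> L i.
Proof.
move=> dm /HJ_decomposes[t [n dn]]; rewrite (decomposes_unique dm dn) => ni.
by case: dn => _ /(_ _ ni)[].
Qed.

Lemma HJ_disjoint J L a : (forall i, J i -> L i -> False) ->
  HJ J a -> HJ L a -> a = 0.
Proof.
move=> JL /HJ_decomposes[s [m dm]] La; have [us ms Hm ->] := dm.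
apply: big1 => i _; apply: contrapT => mi.
by apply: (JL i); [case: (ms _ mi)|apply: decomposes_HJ dm La mi].
Qed.

Lemma HJ_inj J L : HJ J `<=` HJ L -> J `<=` L.
Proof.
move=> JL j Jj; have [a Ha a0] := H1_nontrivial j; apply: contrapT => Lj.
apply: a0; apply: (@HJ_disjoint [set j] L); first by move=> i /= ->.
  exact: HJ_H1 Ha.
by apply: JL; apply: HJ_H1 Ha.
Qed.

End Decomposition.

(** * The socle of H(I,J)/H(I,L) *)

Section Socle.
Local Open Scope ring_scope.
Variables (aleph : pointedType) (K : fieldType).
Variables (d : Order.disp_t) (I : porderType d).
Hypothesis aleph_infinite : infinite_set [set: aleph].
Local Notation X := (@Xidx aleph d I).
Local Notation V := (X -> X -> K).
Local Notation HJ J := (rng_set (H aleph K J) : set V).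

Variables (J L : set I).
Hypothesis lowL : lower_in J L.
Local Notation min_over := (minimal_over (HJ J) (@mmul K X) (HJ L)).
Local Notation Rng_J := (Rng (HJ J) 0 -%R +%R (@mmul K X)).
Implicit Types (x y z w : X) (i j k : I) (a b : V).

Lemma HJ_mulJ a b : HJ J a -> HJ J b -> HJ J (mmul a b).
Proof. exact: HJ_mul. Qed.

Lemma HJ_lower_mull D a b : lower_in J D -> HJ J a -> HJ D b -> HJ D (mmul a b).
Proof.
move=> [_ lowD]; apply: HJ_mul => i j Ji Dj; split=> // ij.
exact: lowD Dj Ji ij.
Qed.

Lemma HJ_lower_mulr D a b : lower_in J D -> HJ D a -> HJ J b -> HJ D (mmul a b).
Proof.
move=> [_ lowD]; apply: HJ_mul => i j Di Jj; split=> // ji.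
exact: lowD Di Jj ji.
Qed.

Lemma HJ_right_ideal D : lower_in J D -> right_ideal (R := Rng_J) (HJ D).
Proof.
move=> lowD; split.
- exact: HJ_sub lowD.1.
- exact: HJ_0.
- exact: HJ_opp.
- exact: HJ_add.
- move=> a b; exact: HJ_lower_mulr.
Qed.

Section MinimalElement.
Variable j : I.
Hypothesis minj : minimal_elements (J `\` L) j.

(* T is a minimal right ideal of H1 j, and H1 j is an ideal modulo HJ L. *)
Lemma minimal_over_translate (T : set V) : T `<=` H1 j -> T 0 ->
  (forall a, T a -> T (- a)) -> (forall a b, T a -> T b -> T (a + b)) ->
  (exists2 a, T a & a <> 0) ->
  (forall i a b, (j <= i)%O -> T a -> H1 i b -> T (mmul a b)) ->
  (forall a b, T a -> T b -> a <> 0 -> exists2 r, H1 j r & mmul a r = b) ->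
  min_over [set c | exists a b, [/\ HJ L a, T b & c = a + b]].
Proof.
move=> TH T0 TN TD [t0 Tt0 t00] TM Ttrans.
have [[Jj nLj] jmin] := minj.
have LJ : HJ L `<=` HJ J := HJ_sub lowL.1.
have TJ : T `<=` HJ J by move=> a /TH; apply: HJ_H1.
split; first split.
- by move=> _ [a [b [La Tb ->]]]; apply: HJ_add; [apply: LJ|apply: TJ].
- by exists 0, 0; split; rewrite ?addr0 //; apply: HJ_0.
- move=> _ [a [b [La Tb ->]]]; exists (- a), (- b); split; [exact: HJ_opp|exact: TN|].
  by rewrite /= opprD.
- move=> _ _ [a [b [La Tb ->]]] [a' [b' [La' Tb' ->]]].
  exists (a + a'), (b + b'); split; [exact: HJ_add|exact: TD|].
  by rewrite /= addrACA.
- move=> _ r [a [b [La Tb ->]]] Jr.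
  have [a' [b' [La' Tb' br]]] : exists a' b', [/\ HJ L a', T b' & mmul b r = a' + b'].
    suff h c : HJ J c -> CFM c /\ exists a' b', [/\ HJ L a', T b' & mmul b c = a' + b'].
      by have [] := h r Jr.
    move: c; apply: HJ_ind.
    + split; first exact: (HJ_CFM (HJ_0 aleph K J)).
      by exists 0, 0; rewrite mmul0r addr0; split=> //; apply: HJ_0.
    + move=> c c' [Cc [u [v [Lu Tv E]]]] [Cc' [u' [v' [Lu' Tv' E']]]].
      split; first exact: CFM_add.
      exists (u + u'), (v + v'); split; [exact: HJ_add|exact: TD|].
      by rewrite mmulDr // E E' addrACA.
    + move=> i c Ji Hc; split; first exact: H1_CFM Hc.
      have [ji|nji] := boolP (j <= i)%O.
        by exists 0, (mmul b c); rewrite add0r; split; [exact: HJ_0|exact: TM ji _ _|].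
      have [ij|nij] := boolP (i <= j)%O; last first.
        exists 0, 0; rewrite (H1_mul_incomparable nji nij (TH _ Tb) Hc) addr0.
        by split=> //; apply: HJ_0.
      (* Here [i] is in [J] and strictly below [j], so minimality of [j] outside [L] puts it in
         [L]. *)
      have Li : L i.
        apply: contrapT => nLi; move: nji; rewrite (jmin i) ?lexx //.
      exists (mmul b c), 0; rewrite addr0; split=> //.
      apply: HJ_H1 Li _; apply: (@H1_mull_lt _ _ _ _ i j) => //; last exact: TH.
      by rewrite lt_leAnge ij.
  exists (mmul a r + a'), b'; split=> //.
    apply: HJ_add => //; exact: HJ_lower_mulr lowL La Jr.
  by rewrite /= mmulDl ?br ?addrA //; apply: (HJ_CFM Jr).
- by move=> a La; exists a, 0; rewrite addr0.
- move=> SE; apply: t00; apply: (@HJ_disjoint _ _ _ _ aleph_infinite [set j] L).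
  + by move=> i ->.
  + by apply: HJ_H1 (TH _ Tt0).
  + by rewrite -SE; exists 0, t0; rewrite add0r; split=> //; apply: HJ_0.
- move=> N [NJ N0 NN ND NM] LN NT.
  have [NL|NL] := pselect (N `<=` HJ L).
    by left; apply/seteqP; split.
  right; apply/seteqP; split=> //.
  have [x Nx nLx] : exists2 x, N x & ~ HJ L x.
    by apply: contrapT => h; apply: NL => x Nx; apply: contrapT => nx; apply: h; exists x.
  (* Since [N] contains H(I,L), the [T]-part [b] of [x] is in [N]; it is nonzero, so it reaches
     every element of [T] by right multiplication. *)
  have [a [b [La Tb xE]]] := NT _ Nx.
  have b0 : b <> 0 by move=> b0; apply: nLx; rewrite xE b0 addr0.
  have Nb : N b.
    have -> : b = x - a by rewrite xE addrAC subrr add0r.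
    by apply: ND => //; apply: NN; apply: LN.
  move=> _ [a' [b' [La' Tb' ->]]]; apply: ND; first exact: LN.
  have [r Hr <-] := Ttrans _ _ Tb Tb' b0.
  by apply: NM => //; apply: HJ_H1 Hr.
Qed.

Lemma minimal_over_row z : ~ is_maximal j -> Xchain z j ->
  min_over [set c | exists a b, [/\ HJ L a, block j [set z] b & c = a + b]].
Proof.
move=> nmj zj; apply: minimal_over_translate.
- by move=> a Ba; apply/H1P; left; split=> //; exists [set z].
- by split=> [x y|//|x y]; rewrite /= eqxx.
- by move=> a; apply: block_opp.
- by move=> a b Ba Bb; rewrite /= -(setUid [set z]); apply: block_add.
- exists (row_unit K j z); first exact: row_unit_block.
  move=> /(congr1 (fun a : V => a z z)) /=; rewrite row_unit_diag //.
  by apply/eqP; exact: oner_neq0.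
- move=> i a b ji Ba Hb; apply: block_mulr => //.
    exact: H1_compatible Hb.
  exact: H1_regular_le Hb.
move=> a b [sa ra fa] [sb rb fb] a0.
have [x0 [y0 nz]] := mx_neq0 a0.
have s0 := sa _ _ nz; have [x0j y0j _] := s0.
have row (c : V) x y (fc : rows_in j [set z] c) : c x y != 0 -> same j x z.
  by move=> /fc[_ ->].
have x0z := row _ _ _ fa nz.
have [g gP] : exists g : X -> X,
    forall y, Xchain y j -> sim j (g y) y /\ same j (g y) x0.
  suff /choice[g gP] : forall y, exists w,
    Xchain y j -> sim j w y /\ same j w x0 by exists g.
  move=> y; have [yj|nyj] := pselect (Xchain y j); last by exists y.
  by have [w wy wx] := Xglue yj x0j; exists w.
(* One elimination step with pivot [a x0 y0]: up to [same j], the only nonzero row of [r] is at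
   [y0], and it is the row of [b] divided by the pivot. The index [g u] locates that row of [b] in
   the class of column [u]. *)
pose r : V := fun t u =>
  if `[< same j t y0 /\ sim j t u >] then (a x0 y0)^-1 * b (g u) u else 0.
have r0 t u : r t u != 0 -> same j t y0 /\ sim j t u.
  by rewrite /r; case: asboolP => //; rewrite eqxx.
have Br : block j [set y0] r.
  split=> [t u /r0[]//|t u t' u' s s' tt' uu'|t u /r0[]]; last by exists y0.
  rewrite /r; have [ty|nty] := pselect (same j t y0); last first.
    have nty' : ~ same j t' y0 by move=> ty; apply: nty; exact: same_trans tt' ty.
    by rewrite !asboolF // => -[].
  have ty' : same j t' y0 := same_trans (same_sym tt') ty.
  rewrite !asboolT //.
  have [_ uj _] := s; have [_ uj' _] := s'.
  have [gu gx] := gP _ uj; have [gu' gx'] := gP _ uj'.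
  by congr (_ * _); apply: rb => //; apply: same_trans gx (same_sym gx').
exists r; first by apply/H1P; left; split=> //; exists [set y0].
apply/funext => p; apply/funext => q.
have [[spq px0]|out] := pselect (sim j p q /\ same j p x0); last first.
  rewrite mmul_eq0.
    apply/esym/eqP; apply/negPn/negP => nb; apply: out; split; first exact: sb.
    exact: same_trans (row _ _ _ fb nb) (same_sym x0z).
  move=> t nat /r0[_ stq]; apply: out; split; first exact: sim_trans (sa _ _ nat) stq.
  exact: same_trans (row _ _ _ fa nat) (same_sym x0z).
have [pj qj _] := spq.
have [t tp ty] := Xglue pj y0j.
rewrite /mmul (fsum_single (z := t)); last first.
  move=> t' tt'; have [/eqP ->|/sa pt'] := boolP (a p t' == 0); first by rewrite mul0r.
  have [/eqP ->|/r0[ty' _]] := boolP (r t' q == 0); first by rewrite mulr0.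
  case: tt'; apply: (@sim_same_eq _ _ _ j).
    exact: sim_trans (sim_sym pt') (sim_sym tp).
  exact: same_trans ty' (same_sym ty).
have [gq gx] := gP _ qj.
have gqE : g q = p.
  apply: (@sim_same_eq _ _ _ j); first exact: sim_trans gq (sim_sym spq).
  exact: same_trans gx (same_sym px0).
rewrite /r asboolT; last by split=> //; apply: sim_trans tp spq.
by rewrite gqE (ra p t x0 y0) // ?mulVKf //; apply: sim_sym.
Qed.

(** Here [H1 j] is a line spanned by an idempotent, so its nonzero elements are invertible in it and
    [T] can be all of [H1 j]. *)
Lemma minimal_over_maximal : is_maximal j ->
  min_over [set c | exists a b, [/\ HJ L a, H1 j b & c = a + b]].
Proof.
move=> mj; apply: minimal_over_translate => //.
- exact: H1_0.
- exact: H1_opp.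
- exact: H1_add.
- exact: H1_nontrivial.
- move=> i a b ji Ha Hb; rewrite (mj _ ji) in Hb; exact: H1_mul.
- move=> a b /H1P[[]//|[_ [c ->]]] /H1P[[]//|[_ [c' ->]]] c0.
  have c_neq0 : c != 0.
    apply/eqP => cE; apply: c0; apply/funext => x; apply/funext => y.
    by rewrite cE mul0r.
  exists (fun x y => (c^-1 * c') * unit_at K j x y).
    by apply/H1P; right; split=> //; exists (c^-1 * c').
  by rewrite mmul_unit_at mulVKf.
Qed.

End MinimalElement.

(** The criterion of [Soc_quotientP] for the ideal H(I,L). *)
Definition sum_minimal_over a := exists2 r : seq V,
  (forall b, b \in r -> exists2 M, min_over M & M b) & HJ L (a - \sum_(b <- r) b).

Lemma sum_minimal_over_L a : HJ L a -> sum_minimal_over a.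
Proof. by move=> La; exists [::] => //; rewrite big_nil subr0. Qed.

Lemma sum_minimal_over_add a b : sum_minimal_over a -> sum_minimal_over b ->
  sum_minimal_over (a + b).
Proof.
move=> [r rP ra] [t tP tb]; exists (r ++ t).
  by move=> c; rewrite mem_cat => /orP[/rP|/tP].
by rewrite big_cat /= opprD addrACA; apply: HJ_add.
Qed.

Lemma sum_minimal_over_mem M a : min_over M -> M a -> sum_minimal_over a.
Proof.
move=> minM Ma; exists [:: a] => [b|]; first by rewrite inE => /eqP ->; exists M.
by rewrite big_seq1 subrr; apply: HJ_0.
Qed.

(** For [j] not maximal, induction on the finite list of rows: the part [a1] of [a] on one row lies
    in the right ideal of [minimal_over_row], and [a2] has one row fewer to account for. *)
Lemma sum_minimal_over_H1 j a : minimal_elements (J `\` L) j -> H1 j a ->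
  sum_minimal_over a.
Proof.
move=> minj Ha; have [mj|nmj] := pselect (is_maximal j).
  apply: sum_minimal_over_mem (minimal_over_maximal minj mj) _.
  by exists 0, a; rewrite add0r; split=> //; apply: HJ_0.
have [Z + Ba] := H1_nonmax nmj Ha.
move=> /finite_seqP[s ZE]; rewrite {}ZE in Ba.
elim: s a {Ha} Ba => [|z s IH] a [sa ra fa].
  suff -> : a = 0 by apply: sum_minimal_over_L; apply: HJ_0.
  apply/funext => x; apply/funext => y; apply/eqP; apply/negPn/negP => nz.
  by have [] := fa _ _ nz.
pose a1 : V := fun x y => if `[< same j x z >] then a x y else 0.
pose a2 : V := fun x y => if `[< same j x z >] then 0 else a x y.
have -> : a = a1 + a2.
  apply/funext => x; apply/funext => y; rewrite !fctE /a1 /a2.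
  by case: asboolP; rewrite ?addr0 ?add0r.
have same_eq x x' : same j x x' -> `[< same j x z >] = `[< same j x' z >].
  move=> xx'; apply/asboolP/asboolP; first exact: same_trans (same_sym xx').
  exact: same_trans.
have a1P x y : a1 x y != 0 -> same j x z /\ a x y != 0.
  by rewrite /a1; case: asboolP => //; rewrite eqxx.
have a2P x y : a2 x y != 0 -> ~ same j x z /\ a x y != 0.
  by rewrite /a2; case: asboolP => //; rewrite eqxx.
apply: sum_minimal_over_add; last first.
  apply: IH; split.
  - by move=> x y /a2P[_ /sa].
  - move=> x y x' y' s1 s2 xx' yy'.
    by rewrite /a2 (same_eq _ _ xx') (ra _ _ _ _ s1 s2 xx' yy').
  - move=> x y /a2P[nxz /fa[z' + xz']].
    rewrite /= inE => /predU1P[z'z|z's]; last by exists z'.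
    by case: nxz; rewrite -z'z.
have [zj|nzj] := pselect (Xchain z j); last first.
  suff -> : a1 = 0 by apply: sum_minimal_over_L; apply: HJ_0.
  apply/funext => x; apply/funext => y; apply/eqP; apply/negPn/negP => nz.
  by have [[_ zj _ _] _] := a1P _ _ nz.
apply: sum_minimal_over_mem (minimal_over_row minj nmj zj) _.
exists 0, a1; rewrite add0r; split; [exact: HJ_0| |by []].
split.
- by move=> x y /a1P[_ /sa].
- move=> x y x' y' s1 s2 xx' yy'.
  by rewrite /a1 (same_eq _ _ xx') (ra _ _ _ _ s1 s2 xx' yy').
- by move=> x y /a1P[xz _]; exists z.
Qed.

Lemma minimal_over_sub M : min_over M ->
  M `<=` HJ (L `|` minimal_elements (J `\` L)).
Proof.
move=> [[MJ M0 MN MD MM] LM ML minM] a Ma.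
have [s [m dm]] := HJ_decomposes (MJ _ Ma).
have [us ms Hm aE] := dm.
suff supp i : m i <> 0 -> ~ L i -> minimal_elements (J `\` L) i.
  rewrite aE; apply: big_ind => [||i _]; [exact: HJ_0|exact: HJ_add|].
  have [->|mi] := pselect (m i = 0); first exact: HJ_0.
  apply: HJ_H1 (Hm i).
  by have [|nLi] := pselect (L i); [left|right; apply: supp].
move=> mi0 nLi0; apply: contrapT => nmin.
have [Ji0 si0] := ms _ mi0.
have [k [Jk nLk ki]] : exists k, [/\ J k, ~ L k & (k < i)%O].
  apply: contrapT => none; apply: nmin; split=> // k [Jk nLk] ki.
  apply: contrapT => /eqP kni; apply: none; exists k; split=> //.
  by rewrite lt_neqAle kni.
(* Removing the components in [L] changes [a] by an element of H(I,L), hence stays inside [M]. *)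
pose m' l := if `[< L l >] then 0 else m l.
have m'P l : m' l <> 0 -> m l <> 0 /\ ~ L l by rewrite /m'; case: asboolP.
pose a' := \sum_(l <- s) m' l.
have Hm' l : H1 l (m' l) by rewrite /m'; case: asboolP => _; [exact: H1_0|].
have dm' : decomposes (J `\` L) s m' a'.
  by split=> // l /m'P[/ms[Jl ls] nLl].
have Ma' : M a'.
  have -> : a' = a - \sum_(l <- s) (m l - m' l).
    by rewrite aE sumrB opprB addrC subrK.
  apply: MD => //; apply: MN; apply: LM; apply: big_ind => [||l _].
  - exact: HJ_0.
  - exact: HJ_add.
  - rewrite /m'; case: asboolP => Ll; last by rewrite subrr; apply: HJ_0.
    by rewrite subr0; apply: HJ_H1 (Hm l).
have m'i : m' i <> 0 by rewrite /m' asboolF.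
have [j [sj mj ij jmax]] := seq_maximal_above (P := [set l | m' l <> 0]) si0 m'i.
have kj : (k < j)%O := lt_le_trans ki ij.
have [x [y [yk nz]]] : exists x y, Xchain y k /\ a' x y != 0.
  apply: (@sum_entry_neq0 _ _ _ _ aleph_infinite s m' j k) => //; last exact: ltW.
  move=> l sl jl; apply: contrapT => ml; have := jmax l sl ml.
  by rewrite jl.
pose u := mmul a' (row_unit K k y).
have u0 : u <> 0.
  move=> /(congr1 (fun a : V => a x y)) /=.
  by rewrite /u mmul_row_unit //; apply/eqP.
have Hr : H1 k (row_unit K k y) := row_unit_H1 K y (not_maximal_lt kj).
have Mu : M u by apply: MM => //; apply: HJ_H1 Hr.
have HJa' : HJ (J `\` L) a'.
  rewrite /a'; apply: big_ind => [||l _]; [exact: HJ_0|exact: HJ_add|].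
  have [->|/m'P[ml nLl]] := pselect (m' l = 0); first exact: HJ_0.
  by apply: HJ_H1 (Hm' l); split=> //; case: (ms _ ml).
have Hu : HJ [set l | [/\ J l, ~ L l & (l <= k)%O]] u.
  apply: (@HJ_mul _ _ _ _ (J `\` L) [set k]) => //; last exact: HJ_H1 Hr.
  by move=> l _ [Jl nLl] ->; split.
pose D := L `|` [set l | J l /\ (l <= k)%O].
have lowD : lower_in J D.
  split=> [l [/lowL.1//|[]//]|l l' [Ll|[Jl lk]] Jl' l'l].
    by left; apply: lowL.2 Ll Jl' l'l.
  by right; split=> //; apply: le_trans lk.
have [DJ D0 DN DD DM] := HJ_right_ideal lowD.
(* This right ideal lies between H(I,L) and [M] but equals neither: it contains [u], a nonzero
   element with support off [L], and it misses [a'], whose component at [j] is outside [D]. *)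
case: (minM (M `&` HJ D)).
- split.
  + by move=> b [/MJ].
  + by split.
  + by move=> b [Mb Db]; split; [apply: MN|apply: DN].
  + by move=> b c [Mb Db] [Mc Dc]; split; [apply: MD|apply: DD].
  + by move=> b r [Mb Db] Jr; split; [apply: MM|apply: DM].
- by move=> b Lb; split; [apply: LM|apply: HJ_sub Lb => l; left].
- by move=> b [].
- move=> MDL; apply: u0.
  apply: (@HJ_disjoint _ _ _ _ aleph_infinite _ L _ _ Hu); first by move=> l [].
  rewrite -MDL; split=> //; apply: HJ_sub Hu => l [Jl _ lk]; right; split=> //.
- move=> MDM; have [_ HDa'] : (M `&` HJ D) a' by rewrite MDM.
  have [_ nLj] := m'P _ mj.
  have [//|[_ jk]] := decomposes_HJ aleph_infinite dm' HDa' mj.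
  by have := lt_le_trans kj jk; rewrite ltxx.
Qed.

Lemma Soc_quotient_HJ a : HJ J a ->
  Soc (quotient_rng (R := H aleph K J) (HJ L)) (coset (R := H aleph K J) (HJ L) a)
  <-> HJ (L `|` minimal_elements (J `\` L)) a.
Proof.
move=> Ja.
have lowJ : lower_in J J by split.
have SP := @Soc_quotientP V (HJ J) (@mmul K X) (@HJ_opp _ _ _ _ J) (@HJ_add _ _ _ _ J)
  HJ_mulJ (fun (a b c : V) _ _ Jc => mmulDl a b (HJ_CFM Jc))
  (fun (a b c : V) _ Jb Jc => mmulDr a (HJ_CFM Jb) (HJ_CFM Jc))
  (HJ L) (HJ_sub lowL.1) (HJ_0 _ _ L) (@HJ_opp _ _ _ _ L) (@HJ_add _ _ _ _ L)
  (fun a b => @HJ_lower_mull L a b lowL) (fun a b => @HJ_lower_mulr L a b lowL) a Ja.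
apply: (iff_trans SP); split.
  move=> [r rP Lr]; rewrite -[a](subrK (\sum_(b <- r) b)); apply: HJ_add.
    by apply: HJ_sub Lr => i; left.
  rewrite big_seq; apply: big_ind => [||b /rP[M minM]]; [exact: HJ_0|exact: HJ_add|].
  exact: minimal_over_sub.
move: a {Ja SP}; apply: HJ_ind.
- by apply: sum_minimal_over_L; apply: HJ_0.
- exact: sum_minimal_over_add.
- move=> j a [Lj|minj] Ha; last exact: sum_minimal_over_H1 Ha.
  by apply: sum_minimal_over_L; apply: HJ_H1 Ha.
Qed.

End Socle.

(** * Comparison of the Loewy chain with the dual Krull filtration *)

Section LoewyKrull.
Variables (aleph : pointedType) (K : fieldType).
Variables (d : Order.disp_t) (I : porderType d).
Hypothesis aleph_infinite : infinite_set [set: aleph].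
Implicit Types J L : set I.

Lemma Loewy_dual_krull J (W : woset) (w : W) :
  Loewy (H aleph K J) w = rng_set (H aleph K (dual_krull J w)).
Proof.
elim/(well_founded_ind (@wo_wf W)): w => w IH.
have [w0|[v vw]|lw] := ord_cases w.
- rewrite /Loewy /dual_krull !transfinite0 //; apply/seteqP; split=> [_ ->|].
    exact: HJ_0.
  by apply: HJ_ind => // a b -> ->; apply: addr0.
- rewrite (dual_krull_sub_succ _ vw) /Loewy (transfinite_succ _ _ vw) -/(Loewy _ v).
  rewrite (IH _ vw.1); have low := dual_krull_lower J v.
  apply/seteqP; split=> a; first by case=> Ja /(Soc_quotient_HJ aleph_infinite low Ja).
  move=> Ha; have Ja : rng_set (H aleph K J) a.
    by apply: HJ_sub Ha => i [/low.1//|[[]]].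
  by split=> //; apply/(Soc_quotient_HJ aleph_infinite low Ja).
- rewrite /Loewy transfinite_limit //.
  have {}IH v : (v < w)%O -> transfinite [set rng_zero (H aleph K J)]
      (fun S => [set x | rng_set (H aleph K J) x /\ Soc (quotient_rng S) (coset S x)]) v
      = rng_set (H aleph K (dual_krull J v)) by exact: IH.
  apply/seteqP; split=> [a [v /= vw]|].
    by rewrite IH //; apply: HJ_sub; apply: dual_krull_mono; apply: ltW.
  (* A limit is not zero, so the union is over a nonempty set of stages and contains 0. *)
  have [v0 v0w] : exists v0 : W, (v0 < w)%O.
    apply: contrapT => none; apply: lw.1 => v; rewrite leNgt; apply/negP => vw.
    by apply: none; exists v.
  apply: HJ_ind.
  + by exists v0 => //; rewrite IH //; apply: HJ_0.
  + move=> a b [v /= vw]; rewrite IH // => Ha [u /= uw]; rewrite IH // => Hb.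
    have [vu|/ltW uv] := leP v u.
      exists u => //; rewrite IH //; apply: HJ_add => //.
      by apply: HJ_sub Ha; apply: dual_krull_mono.
    exists v => //; rewrite IH //; apply: HJ_add => //.
    by apply: HJ_sub Hb; apply: dual_krull_mono.
  + move=> j a; rewrite /dual_krull transfinite_limit // => -[v /= vw vj] Ha.
    by exists v => //; rewrite IH //; apply: HJ_H1 Ha.
Qed.

(** By [HJ_inj], a subset of [I] is recovered from its H(I,-), so both filtrations become full at
    the same ordinals. *)
Lemma Loewy_eq J (W : woset) (w : W) :
  Loewy (H aleph K J) w = rng_set (H aleph K J) <-> dual_krull J w = J.
Proof.
rewrite Loewy_dual_krull; split=> [E|->//].
by apply/seteqP; split; apply: (HJ_inj (K := K) aleph_infinite); rewrite E.
Qed.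

Lemma semiartinianP J : semiartinian (H aleph K J) <-> artinian_poset J.
Proof.
split=> [[W [xi /Loewy_eq]]|/artinian_dual_krull[W [xi E]]].
  exact: dual_krull_artinian.
by exists W, xi; apply/Loewy_eq.
Qed.

Lemma Loewy_lengthP J (W : woset) (xi : W) :
  is_Loewy_length (H aleph K J) xi <-> is_dual_krull_dim J xi.
Proof.
split=> -[/Loewy_eq E minxi]; split=> // w /minxi ne.
  by move=> /Loewy_eq.
by move=> /Loewy_eq.
Qed.

Lemma artinian_Loewy_length J : artinian_poset J ->
  exists (W : woset) (xi : W), is_Loewy_length (H aleph K J) xi.
Proof.
move=> /artinian_dual_krull[W [xi E]].
have [|w wE minw] := @wf_minimal _ _ (@wo_wf W) (fun w => dual_krull J w = J).
  by exists xi.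
by exists W, w; apply/Loewy_lengthP.
Qed.

End LoewyKrull.

Theorem theorem4p5 (aleph : pointedType) (K : fieldType)
    (d : Order.disp_t) (I : porderType d) (J : set I) :
  infinite_set [set: aleph] ->
  aleph_poset aleph I ->
  has_finite_cofinal_subset I ->
  [/\ forall (W : woset) (alpha : W),
        Loewy (H aleph K J) alpha = rng_set (H aleph K (dual_krull J alpha)),
      semiartinian (H aleph K J) <-> artinian_poset J,
      artinian_poset J ->
        (exists (W : woset) (xi : W), is_Loewy_length (H aleph K J) xi) /\
        (forall (W : woset) (xi : W),
           is_Loewy_length (H aleph K J) xi <-> is_dual_krull_dim J xi)
    & semiartinian (frakB aleph K I) <-> artinian_poset [set: I]].
Proof.
move=> aleph_inf _ _; split.
- by move=> W alpha; apply: Loewy_dual_krull.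
- exact: semiartinianP.
- move=> artJ; split; first exact: artinian_Loewy_length.
  by move=> W xi; apply: Loewy_lengthP.
- exact: semiartinianP.
Qed.
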